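(* Let $k$ be an algebraically closed field of characteristic $0$, let $m,d$ be positive integers with $(1+m)d$ even, and let $\xi\in k$ be a primitive $2m$-th root of $1$. Then the algebra $D(m,d,\xi)$ defined in the context, with the $\Delta$, $\epsilon$ and $S$ given there on generators, is a Hopf algebra.
   Context: Put $\omega:=md$, $\gamma:=\xi^2$, and $\phi_i:=1-\gamma^{-i-1}x^d$ for $i\in\mathbb{Z}$. As a $k$-algebra $D(m,d,\xi)$ is generated by $x^{\pm1},g^{\pm1},y,u_0,\dots,u_{m-1}$ with relations (indices of $u$ are read modulo $m$) $$xx^{-1}=x^{-1}x=1,\quad gg^{-1}=g^{-1}g=1,\quad xg=gx,\quad xy=yx,\quad yg=\gamma gy,\quad y^m=1-x^\omega=1-g^m,$$ $$xu_i=u_ix^{-1},\quad yu_i=\phi_iu_{i+1}=\xi x^du_iy,\quad u_ig=\gamma^ix^{-2d}gu_i,$$ and, for $0\le i,j\le m-1$, $u_iu_j=(-1)^{-j}\xi^{-j}\gamma^{\frac{j(j+1)}{2}}\frac1m x^{-\frac{1+m}{2}d}\,P_{ij}\,g$, where $P_{ij}=\phi_i\phi_{i+1}\cdots\phi_{m-2-j}\,y^{i+j}$ if $i+j\le m-2$; $P_{ij}=y^{i+j}$ if $i+j=m-1$; and $P_{ij}=\phi_i\cdots\phi_{m-1}\phi_0\cdots\phi_{m-2-j}\,y^{i+j-m}$ otherwise (where $\phi_0\cdots\phi_{m-2-j}$ is the empty product $1$ if $j=m-1$). The coproduct, counit and antipode are given by: $\Delta(x)=x\otimes x$, $\Delta(g)=g\otimes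 g$, $\Delta(y)=y\otimes g+1\otimes y$, $\Delta(u_i)=\sum_{j=0}^{m-1}\gamma^{j(i-j)}u_j\otimes x^{-jd}g^ju_{i-j}$; $\epsilon(x)=\epsilon(g)=\epsilon(u_0)=1$, $\epsilon(y)=\epsilon(u_s)=0$ for $1\le s\le m-1$; $S(x)=x^{-1}$, $S(g)=g^{-1}$, $S(y)=-yg^{-1}$, $S(u_i)=(-1)^i\xi^{-i}\gamma^{-\frac{i(i+1)}{2}}x^{id+\frac32(1-m)d}g^{m-i-1}u_i$ for $0\le i\le m-1$ ($\Delta,\epsilon$ extended as algebra homomorphisms, $S$ as an algebra anti-homomorphism). *)

(* Defs.v *)
From HB Require Import structures.
From mathcomp Require Import all_boot all_order all_algebra.
From mathcomp Require Import finmap boolp monalg.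

Set Implicit Arguments.
Unset Strict Implicit.
Unset Printing Implicit Defensive.

Import GRing.Theory.
Local Open Scope ring_scope.

(* Unital associative k-algebras.  The library's [algType] requires [1 != 0],
   which cannot be asserted in advance for an algebra given by generators and
   relations, or for a tensor product of algebras. *)
HB.mixin Record Lmodule_isUnitalAlgebra (k : pzRingType) A
    of GRing.Lmodule k A := {
  aone : A;
  amul : A -> A -> A;
  amulA : associative amul;
  amul1l : left_id aone amul;
  amul1r : right_id aone amul;
  amul_linearl : forall b, linear (amul^~ b);
  amul_linearr : forall a, linear (amul a)
}.

#[short(type="ualgType")]
HB.structure Definition UnitalAlgebra (k : pzRingType) :=
  {A of GRing.Lmodule k A & Lmodule_isUnitalAlgebra k A}.

Arguments aone {k s}.
Notation "a ** b" := (amul a b) (at level 40, left associativity) : ring_scope.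

Section Span.
Variables (R : pzRingType) (V : lmodType R) (S : V -> Prop).

Definition submodule (W : V -> Prop) : Prop :=
  W 0 /\ forall (c : R) (u v : V), W u -> W v -> W (c *: u + v).

Definition span : pred V := fun v =>
  `[< forall W, submodule W -> (forall s, S s -> W s) -> W v >].

Lemma span_submodule : submodule span.
Proof.
split=> [|c u v /asboolP su /asboolP sv]; apply/asboolP=> W sW SW.
  by case: sW.
by case: (sW) => _; apply; [apply: su | apply: sv].
Qed.

Lemma span_gen s : S s -> span s.
Proof. by move=> Ss; apply/asboolP=> W _; apply. Qed.

Lemma span_ind (W : V -> Prop) : submodule W -> (forall s, S s -> W s) ->
  forall v, span v -> W v.
Proof. by move=> sW SW v /asboolP; apply. Qed.

Fact span_zmod : zmod_closed span.
Proof.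
have [s0 sL] := span_submodule.
by split=> [//|u v su sv]; rewrite addrC -scaleN1r; apply: sL.
Qed.
HB.instance Definition _ := GRing.isZmodClosed.Build V span span_zmod.
Definition span_zmodClosed := GRing.ZmodClosed.clone V span _.

End Span.

Section QuotientModule.
Variables (R : pzRingType) (V : lmodType R) (S : V -> Prop).

Definition quotmod : Type := Quotient.quot (span_zmodClosed S).
HB.instance Definition _ := Choice.on quotmod.
HB.instance Definition _ := GRing.Zmodule.on quotmod.

Definition qproj (v : V) : quotmod := \pi_(Quotient.quot (span_zmodClosed S))%qT v.
Definition qrepr (q : quotmod) : V := repr (q : Quotient.quot (span_zmodClosed S)).

Lemma qreprK q : qproj (qrepr q) = q.
Proof. exact: reprK. Qed.

Lemma qprojP u v : reflect (qproj u = qproj v) (span S (u - v)).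
Proof.
have -> : span S (u - v) = (qproj u == qproj v) by exact: Quotient.idealrBE.
exact: eqP.
Qed.

Lemma qproj_eq u v : S (u - v) -> qproj u = qproj v.
Proof. by move=> Suv; apply/qprojP/span_gen. Qed.

Fact qprojB : zmod_morphism qproj.
Proof. by move=> u v; rewrite /qproj raddfB. Qed.

Definition qscale (c : R) (q : quotmod) : quotmod := qproj (c *: qrepr q).

Lemma qprojZ c v : qproj (c *: v) = qscale c (qproj v).
Proof.
apply/qprojP; rewrite -scalerBr -[_ *: _]addr0.
have [s0 sL] := span_submodule S; apply: sL => //.
by apply/qprojP; rewrite qreprK.
Qed.

HB.instance Definition _ := GRing.isZmodMorphism.Build V quotmod qproj qprojB.

Fact qscaleA a b q : qscale a (qscale b q) = qscale (a * b) q.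
Proof. by rewrite -[q]qreprK -!qprojZ scalerA. Qed.
Fact qscale1 : left_id 1 qscale.
Proof. by move=> q; rewrite -[q]qreprK -!qprojZ scale1r. Qed.
Fact qscaleDr : right_distributive qscale +%R.
Proof.
move=> c p q; rewrite -[p]qreprK -[q]qreprK -raddfD -!qprojZ -raddfD.
by rewrite scalerDr.
Qed.
Fact qscaleDl q : {morph qscale^~ q : a b / a + b}.
Proof. by move=> a b; rewrite -[q]qreprK -!qprojZ -raddfD scalerDl. Qed.
HB.instance Definition _ :=
  GRing.Zmodule_isLmodule.Build R quotmod qscaleA qscale1 qscaleDr qscaleDl.

HB.instance Definition _ := GRing.isScalable.Build R V quotmod *:%R qproj qprojZ.

Lemma qproj_linear : linear qproj.
Proof. exact: linearP. Qed.

Lemma qproj_surj q : exists v, q = qproj v.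
Proof. by exists (qrepr q); rewrite qreprK. Qed.

Section Lift.
Variables (C : lmodType R) (f : V -> C).
Hypothesis linf : linear f.
Hypothesis f0 : forall s, S s -> f s = 0.

Lemma qrepr_lift v : f (qrepr (qproj v)) = f v.
Proof.
have fB (u w : V) : f (u - w) = f u - f w.
  by rewrite addrC -scaleN1r linf scaleN1r addrC.
have f00 : f 0 = 0 by rewrite -(subrr 0) fB subrr.
have fs w : span S w -> f w = 0.
  move: w; apply: span_ind => //; split=> // c x y fx fy.
  by rewrite linf fx fy scaler0 addr0.
apply/eqP; rewrite -subr_eq0 -fB; apply/eqP/fs.
by apply/qprojP; rewrite qreprK.
Qed.
End Lift.
End QuotientModule.

Section LinearExtension.
Variables (R : comNzRingType) (K : choiceType) (C : lmodType R) (h : K -> C).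

Definition linext (g : {malg R[K]}) : C := \sum_(p <- msupp g) g@_p *: h p.

Lemma linextE (E : {fset K}) g : (msupp g `<=` E)%fset ->
  linext g = \sum_(p <- E) g@_p *: h p.
Proof.
move=> sE; rewrite [LHS](big_fset_incl _ sE) //= => p _ /mcoeff_outdom ->.
by rewrite scale0r.
Qed.

Lemma linext_linear : linear linext.
Proof.
move=> c g g'; pose E := (msupp (c *: g + g') `|` (msupp g `|` msupp g'))%fset.
rewrite !(@linextE E) ?fsubsetUl //; last first.
- by rewrite /E fsetUCA fsubsetUl.
- by rewrite /E fsetUA fsubsetUr.
rewrite scaler_sumr -big_split /=; apply: eq_bigr => p _.
by rewrite mcoeffD mcoeffZ scalerDl scalerA.
Qed.
HB.instance Definition _ := GRing.isLinear.Build R _ _ _ linext linext_linear.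

Lemma linextU p : linext << p >> = h p.
Proof. by rewrite (linextE msuppU_le) big_seq_fset1 mcoeffUU scale1r. Qed.
End LinearExtension.

Lemma linear_comb (R : comNzRingType) (U V : lmodType R) (c : R) (f g : U -> V) :
  linear f -> linear g -> linear (fun t => c *: f t + g t).
Proof.
move=> lf lg e u v; rewrite lf lg !scalerDr !scalerA (mulrC c) addrACA.
by [].
Qed.

Section TensorProduct.
Variables (R : comNzRingType).
Implicit Types A B C : lmodType R.

Inductive bilin_rel (A B : lmodType R) :
    {malg R[Choice.clone (A * B)%type _]} -> Prop :=
| BilinLeft c (a a' : A) (b : B) :
    bilin_rel (<< (c *: a + a', b) >> - (c *: << (a, b) >> + << (a', b) >>))
| BilinRight c (a : A) (b b' : B) :
    bilin_rel (<< (a, c *: b + b') >> - (c *: << (a, b) >> + << (a, b') >>)).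

Definition tens (A B : lmodType R) : Type := quotmod (@bilin_rel A B).
HB.instance Definition _ A B := GRing.Lmodule.on (tens A B).

Definition pure (A B : lmodType R) (a : A) (b : B) : tens A B :=
  qproj (@bilin_rel A B) << (a, b) >>.

Definition bilinear (A B C : lmodType R) (f : A -> B -> C) : Prop :=
  (forall b, linear (f^~ b)) /\ (forall a, linear (f a)).

(* The linear map induced by [f]; meaningful when [f] is bilinear. *)
Definition tens_lift (A B C : lmodType R) (f : A -> B -> C) (t : tens A B) : C :=
  linext (fun p => f p.1 p.2) (qrepr t).

Lemma pure_bilinear A B : bilinear (@pure A B).
Proof.
split=> [b c a a'|a c b b'];
  apply: etrans (@qproj_linear _ _ (@bilin_rel A B) _ _ _); apply: qproj_eq.
- exact: BilinLeft.
- exact: BilinRight.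
Qed.

Lemma tens_lift_proj A B C (f : A -> B -> C) z : bilinear f ->
  tens_lift f (qproj (@bilin_rel A B) z) = linext (fun p => f p.1 p.2) z.
Proof.
case=> fl fr; apply: qrepr_lift; first exact: linext_linear.
by move=> _ [c a a' b|c a b b'];
  rewrite linearB linearP /= !linextU /= ?fl ?fr subrr.
Qed.

Lemma tens_liftE A B C (f : A -> B -> C) a b : bilinear f ->
  tens_lift f (pure a b) = f a b.
Proof. by move=> bf; rewrite tens_lift_proj // linextU. Qed.

Lemma tens_lift_linear A B C (f : A -> B -> C) : bilinear f ->
  linear (tens_lift f).
Proof.
move=> bf c t t'.
have [[z ->] [z' ->]] := (qproj_surj t, qproj_surj t').
by rewrite -(@qproj_linear _ _ (@bilin_rel A B)) !tens_lift_proj // linearP.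
Qed.

Lemma tens_ind A B (P : tens A B -> Prop) : submodule P ->
  (forall a b, P (pure a b)) -> forall t, P t.
Proof.
move=> [P0 PL] Pp t; have [z ->] := qproj_surj t.
rewrite [z]monalgE raddf_sum; elim/big_ind: _ => // [u v Pu Pv|[a b] _].
  by rewrite -[u]scale1r; apply: PL.
have -> : << z@_(a, b) *g (a, b) >> = z@_(a, b) *: << (a, b) >>.
  by apply/malgP=> p; rewrite mcoeffZ !mcoeffU mulrnAr mulr1.
by rewrite /= linearZ_LR; have := PL z@_(a, b) _ _ (Pp a b) P0; rewrite addr0.
Qed.

Lemma eq_linear_tens A B C (f g : tens A B -> C) : linear f -> linear g ->
  (forall a b, f (pure a b) = g (pure a b)) -> f =1 g.
Proof.
move=> lf lg fg; apply: tens_ind => //.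
have f0 (h : tens A B -> C) : linear h -> h 0 = 0.
  move=> lh; have := lh (-1) 0 0.
  by rewrite scaler0 addr0 scaleN1r addNr.
split=> [|c u v eu ev]; first by rewrite !f0.
by rewrite lf lg eu ev.
Qed.

Definition tens_map (A B A' B' : lmodType R) (f : A -> A') (g : B -> B') :
    tens A B -> tens A' B' :=
  tens_lift (fun a b => pure (f a) (g b)).

Definition tens_assoc (A B C : lmodType R) :
    tens (tens A B) C -> tens A (tens B C) :=
  tens_lift (fun t c => tens_lift (fun a b => pure a (pure b c)) t).

End TensorProduct.

Section TensorAlgebra.
Variables (R : comNzRingType) (A B : ualgType R).

Definition tens_mul (s t : tens A B) : tens A B :=
  tens_lift (fun a b => tens_lift (fun a' b' => pure (a ** a') (b ** b')) t) s.

Let inner_bil a b : bilinear (fun a' b' => pure (a ** a') (b ** b') : tens A B).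
Proof.
have [pl pr] := pure_bilinear A B.
by split=> [y c x x'|x c y y']; rewrite amul_linearr ?pl ?pr.
Qed.

Let outer_bil t : bilinear (fun a b =>
  tens_lift (fun a' b' => pure (a ** a') (b ** b') : tens A B) t).
Proof.
have [pl pr] := pure_bilinear A B.
split=> [b c a a'|a c b b'] /=; move: t; apply: eq_linear_tens.
- exact: tens_lift_linear.
- apply: linear_comb; exact: tens_lift_linear.
- by move=> x y; rewrite !tens_liftE // amul_linearl pl.
- exact: tens_lift_linear.
- apply: linear_comb; exact: tens_lift_linear.
- by move=> x y; rewrite !tens_liftE // amul_linearl pr.
Qed.

Lemma tens_mul_pure a b t : tens_mul (pure a b) t =
  tens_lift (fun a' b' => pure (a ** a') (b ** b')) t.
Proof. exact: (tens_liftE a b (outer_bil t)). Qed.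

Lemma tens_mul_linearl t : linear (tens_mul^~ t).
Proof. exact: tens_lift_linear. Qed.

Lemma tens_mul_linearr s : linear (tens_mul s).
Proof.
move=> c t t'; move: s; apply: eq_linear_tens.
- exact: tens_lift_linear.
- apply: linear_comb; exact: tens_mul_linearl.
- move=> a b; rewrite !tens_mul_pure; exact: (tens_lift_linear (inner_bil a b)).
Qed.

Lemma tens_mulE a b a' b' :
  tens_mul (pure a b) (pure a' b') = pure (a ** a') (b ** b').
Proof. by rewrite tens_mul_pure (tens_liftE _ _ (inner_bil _ _)). Qed.

Fact tens_mulA : associative tens_mul.
Proof.
move=> s t u; move: s; apply: eq_linear_tens.
- exact: tens_mul_linearl.
- by move=> c x y; rewrite !tens_mul_linearl.
move=> a b; move: t; apply: eq_linear_tens.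
- by move=> c x y; rewrite tens_mul_linearl tens_mul_linearr.
- by move=> c x y; rewrite tens_mul_linearr tens_mul_linearl.
move=> a' b'; move: u; apply: eq_linear_tens.
- by move=> c x y; rewrite !tens_mul_linearr.
- exact: tens_mul_linearr.
by move=> x y; rewrite !tens_mulE !amulA.
Qed.

Fact tens_mul1l : left_id (pure aone aone) tens_mul.
Proof.
apply: (@eq_linear_tens _ _ _ _ _ id) => [||a b].
- exact: tens_mul_linearr.
- by [].
- by rewrite tens_mulE !amul1l.
Qed.

Fact tens_mul1r : right_id (pure aone aone) tens_mul.
Proof.
apply: (@eq_linear_tens _ _ _ _ _ id) => [||a b].
- exact: tens_mul_linearl.
- by [].
- by rewrite tens_mulE !amul1r.
Qed.

HB.instance Definition _ := Lmodule_isUnitalAlgebra.Build R (tens A B)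
  tens_mulA tens_mul1l tens_mul1r tens_mul_linearl tens_mul_linearr.

End TensorAlgebra.

Section HopfAlgebra.
Variables (k : fieldType) (H : ualgType k).

Record is_hopf_algebra (Delta : H -> tens H H) (eps : H -> k) (S : H -> H) :
    Prop := IsHopfAlgebra {
  coproduct_linear : linear Delta;
  coproduct1 : Delta aone = aone;
  coproductM : forall a b, Delta (a ** b) = Delta a ** Delta b;
  counit_linear : linear (eps : H -> k^o);
  counit1 : eps aone = 1;
  counitM : forall a b, eps (a ** b) = eps a * eps b;
  antipode_linear : linear S;
  coassociativity : forall a,
    tens_assoc (tens_map Delta id (Delta a)) = tens_map id Delta (Delta a);
  counitl : forall a, tens_lift (fun x y => eps x *: y) (Delta a) = a;
  counitr : forall a, tens_lift (fun x y => eps y *: x) (Delta a) = a;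
  antipodel : forall a,
    tens_lift (fun x y => S x ** y) (Delta a) = eps a *: aone;
  antipoder : forall a,
    tens_lift (fun x y => x ** S y) (Delta a) = eps a *: aone
}.

Definition anti_homomorphism (S : H -> H) : Prop :=
  [/\ linear S, S aone = aone & forall a b, S (a ** b) = S b ** S a].

End HopfAlgebra.

Lemma malg_scalerAr (R : comNzRingType) (M : monomType) (c : R)
    (a b : {malg R[M]}) : c *: (a * b) = a * (c *: b).
Proof.
have ca : c%:MP * a = a * c%:MP.
  rewrite !malgM_def fgmulUg fgmulgU; apply: eq_bigr => i _.
  by rewrite mul1m mulm1 mulrC.
by rewrite -!mul_malgC mulrA ca mulrA.
Qed.

Section PresentedAlgebra.
Variables (k : fieldType) (X : choiceType).

Local Notation free_alg := {malg k[{fmonom X}]}.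

Definition free_gen (i : X) : free_alg := << fmu i >>.

Variable rel : free_alg -> free_alg -> Prop.

(* These elements span the two-sided ideal generated by the differences [l - r]
   for [rel l r]. *)
Inductive ideal_gen : free_alg -> Prop :=
| IdealGen a l r b : rel l r -> ideal_gen (a * (l - r) * b).

Definition presented : Type := quotmod ideal_gen.
HB.instance Definition _ := GRing.Lmodule.on presented.

Definition presented_proj (a : free_alg) : presented := qproj ideal_gen a.

Lemma presented_projL : linear presented_proj.
Proof. exact: qproj_linear. Qed.

Definition presented_mul (p q : presented) : presented :=
  presented_proj (qrepr p * qrepr q).

Lemma span_idealMl a z : span ideal_gen z -> span ideal_gen (a * z).
Proof.
have [s0 sL] := span_submodule ideal_gen.
move: z; apply: span_ind => [|_ [x l r b lr]].
  split=> [|c u v au av]; first by rewrite mulr0.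
  by rewrite mulrDr -(malg_scalerAr c a u); exact: (sL c _ _ au av).
by apply: span_gen; rewrite !mulrA; apply: IdealGen.
Qed.

Lemma span_idealMr a z : span ideal_gen z -> span ideal_gen (z * a).
Proof.
have [s0 sL] := span_submodule ideal_gen.
move: z; apply: span_ind => [|_ [x l r b lr]].
  split=> [|c u v au av]; first by rewrite mul0r.
  by rewrite mulrDl -(scalerAl c u a); exact: (sL c _ _ au av).
by apply: span_gen; rewrite -(mulrA _ b); apply: IdealGen.
Qed.

Lemma presented_projM a b :
  presented_proj (a * b) = presented_mul (presented_proj a) (presented_proj b).
Proof.
apply/qprojP; set a' := qrepr _; set b' := qrepr _.
have -> : a * b - a' * b' = (a - a') * b + a' * (b - b').
  by rewrite mulrBl mulrBr addrA subrK.
have [_ sL] := span_submodule ideal_gen.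
rewrite -[X in X + _]scale1r; apply: sL.
  by apply: span_idealMr; apply/qprojP; rewrite qreprK.
by apply: span_idealMl; apply/qprojP; rewrite qreprK.
Qed.

Let projE p : exists a, p = presented_proj a.
Proof. exact: qproj_surj. Qed.

Fact presented_mulA : associative presented_mul.
Proof.
move=> p q r; have [a ->] := projE p; have [b ->] := projE q.
by have [c ->] := projE r; rewrite -!presented_projM mulrA.
Qed.
Fact presented_mul1l : left_id (presented_proj 1) presented_mul.
Proof. by move=> p; have [a ->] := projE p; rewrite -presented_projM mul1r. Qed.
Fact presented_mul1r : right_id (presented_proj 1) presented_mul.
Proof. by move=> p; have [a ->] := projE p; rewrite -presented_projM mulr1. Qed.
Fact presented_mul_linearl q : linear (presented_mul^~ q).
Proof.
move=> c p p'; have [a ->] := projE p; have [b ->] := projE q.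
have [a' ->] := projE p'.
rewrite -presented_projL -!presented_projM -presented_projL.
by rewrite mulrDl -(scalerAl c a b).
Qed.
Fact presented_mul_linearr q : linear (presented_mul q).
Proof.
move=> c p p'; have [a ->] := projE p; have [b ->] := projE q.
have [a' ->] := projE p'.
rewrite -presented_projL -!presented_projM -presented_projL.
by rewrite mulrDr -(malg_scalerAr c b a).
Qed.

HB.instance Definition _ := Lmodule_isUnitalAlgebra.Build k presented
  presented_mulA presented_mul1l presented_mul1r
  presented_mul_linearl presented_mul_linearr.

End PresentedAlgebra.

Inductive D_gen (m : nat) : Type :=
| Gx | Gxinv | Gg | Gginv | Gy | Gu of 'I_m.
Arguments Gx {m}.
Arguments Gxinv {m}.
Arguments Gg {m}.
Arguments Gginv {m}.
Arguments Gy {m}.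
HB.instance Definition _ m := gen_eqMixin (D_gen m).
HB.instance Definition _ m := gen_choiceMixin (D_gen m).

(* [i - j] modulo [m] *)
Definition ord_sub (m : nat) (i j : 'I_m) : 'I_m :=
  Ordinal (ltn_pmod (i + (m - j)) (leq_ltn_trans (leq0n i) (ltn_ord i))).

Section AlgebraD.
Variables (k : fieldType) (m d : nat) (xi : k).

Local Notation F := {malg k[{fmonom (D_gen m)}]}.
Local Notation gamma := (xi ^+ 2).

Definition fx : F := free_gen k Gx.
Definition fxinv : F := free_gen k Gxinv.
Definition fg : F := free_gen k Gg.
Definition fginv : F := free_gen k Gginv.
Definition fy : F := free_gen k Gy.
Definition fu (i : 'I_m) : F := free_gen k (Gu i).

(* [x ^ n] for an integer exponent, by means of the generator [x^-1] *)
Definition fxz (n : int) : F :=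
  match n with Posz p => fx ^+ p | Negz p => fxinv ^+ p.+1 end.

Definition phi (i : int) : F := 1 - gamma ^ (- i - 1) *: fx ^+ d.

Definition P_ (i j : nat) : F :=
  if (i + j < m - 1)%N then
    (\prod_(i <= l < m - 1 - j) phi l%:Z) * fy ^+ (i + j)
  else if (i + j == m - 1)%N then fy ^+ (i + j)
  else (\prod_(i <= l < m) phi l%:Z) * (\prod_(0 <= l < m - 1 - j) phi l%:Z)
       * fy ^+ (i + j - m).

(* [ordS i] is [i + 1] modulo [m]; the halves are exact, [(1 + m) * d] being
   even. *)
Inductive D_rel : F -> F -> Prop :=
| D_xxinv : D_rel (fx * fxinv) 1
| D_xinvx : D_rel (fxinv * fx) 1
| D_gginv : D_rel (fg * fginv) 1
| D_ginvg : D_rel (fginv * fg) 1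
| D_xg : D_rel (fx * fg) (fg * fx)
| D_xy : D_rel (fx * fy) (fy * fx)
| D_yg : D_rel (fy * fg) (gamma *: (fg * fy))
| D_ym_x : D_rel (fy ^+ m) (1 - fx ^+ (m * d))
| D_ym_g : D_rel (1 - fx ^+ (m * d)) (1 - fg ^+ m)
| D_xu i : D_rel (fx * fu i) (fu i * fxinv)
| D_yu_phi (i : 'I_m) : D_rel (fy * fu i) (phi i%:Z * fu (ordS i))
| D_yu_uy (i : 'I_m) :
    D_rel (phi i%:Z * fu (ordS i)) (xi *: (fx ^+ d * fu i * fy))
| D_ug (i : 'I_m) :
    D_rel (fu i * fg) (gamma ^+ i *: (fxz (- (2 * d)%N%:Z) * fg * fu i))
| D_uu (i j : 'I_m) :
    D_rel (fu i * fu j)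
      (((-1) ^- j * xi ^- j * gamma ^+ (j * (j + 1))./2 * m%:R^-1) *:
       (fxz (- ((1 + m) * d)./2%:Z) * P_ i j * fg)).

Definition algD : Type := presented D_rel.
HB.instance Definition _ := UnitalAlgebra.on algD.

Definition Dproj (a : F) : algD := presented_proj D_rel a.

Definition D_coproduct_gens (Delta : algD -> tens algD algD) : Prop :=
  [/\ Delta (Dproj fx) = pure (Dproj fx) (Dproj fx),
      Delta (Dproj fg) = pure (Dproj fg) (Dproj fg),
      Delta (Dproj fy) =
        pure (Dproj fy) (Dproj fg) + pure (Dproj 1) (Dproj fy) &
      forall i : 'I_m, Delta (Dproj (fu i)) =
        \sum_(j < m) gamma ^ (j%:Z * (i%:Z - j%:Z)) *:
          pure (Dproj (fu j))
               (Dproj (fxz (- (j * d)%N%:Z) * fg ^+ j * fu (ord_sub i j)))].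

Definition D_counit_gens (eps : algD -> k) : Prop :=
  [/\ eps (Dproj fx) = 1, eps (Dproj fg) = 1, eps (Dproj fy) = 0 &
      forall i : 'I_m, eps (Dproj (fu i)) = (i == 0 :> nat)%:R].

(* [3/2 (1 - m) d] is written [- 3 ((m - 1) d / 2)], where the half is exact. *)
Definition D_antipode_gens (S : algD -> algD) : Prop :=
  [/\ S (Dproj fx) = Dproj fxinv,
      S (Dproj fg) = Dproj fginv,
      S (Dproj fy) = Dproj (- (fy * fginv)) &
      forall i : 'I_m, S (Dproj (fu i)) =
        ((-1) ^+ i * xi ^- i * gamma ^- (i * (i + 1))./2) *:
          Dproj (fxz ((i * d)%N%:Z - 3 * ((m - 1) * d)./2%:Z)
                 * fg ^+ (m - i - 1) * fu i)].

End AlgebraD.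

(* Main.v *)
Require Import Defs.
From HB Require Import structures.
From mathcomp Require Import all_boot all_order all_algebra.
From mathcomp Require Import finmap boolp monalg zify ring.

Import GRing.Theory.
Local Open Scope ring_scope.

Set Implicit Arguments.
Unset Strict Implicit.
Unset Printing Implicit Defensive.

(** The algebra D(m, d, xi) is given by generators and relations, so an algebra
    map out of it is a family of elements satisfying the relations
    ([algD_rec]).  Such families are needed in the tensor square for the
    coproduct ([coproduct_laws]), in the ground field for the counit
    ([counit_laws]) and in the opposite algebra for the antipode
    ([antipode_laws]).  Coassociativity and the counit axioms are equalities
    of algebra maps, and an antipode identity passes from two elements to
    their product ([antilM], [antirM]); so all axioms need only be checked on
    generators ([hopf_of_generators]).

    The relation for [u_i u_j] carries the difficulty.  Let the indices of [u]
    range over the integers, periodically, and let [n] be the residue of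
    [i + j] modulo [m].  The three cases of [P_ij] then become one: the product
    of the [m - 1 - n] consecutive factors [phi_i, phi_(i+1), ...], times
    [y ^ n].  At a root of unity [gamma] of order [m] this product expands as
    the sum over [p] of [binom(n + p, p) gamma^(-i p) x^(d p)], with Gaussian
    binomials, which vanish as soon as [n + p >= m] ([Phi_sum]).

    With this expansion a product of two [u]'s is a sum of monomials in [x],
    [g], [y] with explicit powers of [xi] ([uuE]).  In
    [Delta(u_i) Delta(u_j)], a sum over [a] and [b] in which two further sums
    over [p] and [q] arise, put [r = a + b]: then [b] only occurs in
    [gamma ^ (b (r + p - q))], and summing over [b] forces [q = r + p].  The
    other side of the relation contains [Delta(y) ^ n], which the [q]-binomial
    theorem expands.  Comparing coefficients leaves the trinomial identity
    [binom(r + p, r) binom(n + p, n - r) = binom(n, r) binom(n + p, p)]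
    ([qbin_coproduct]); the terms in which indices wrap around modulo [m]
    vanish, again because their binomials do.

    For the antipode, [h = x^(-d) g] satisfies [h ^ m = 1], and the given value
    on [u_i] is a power of [xi] times [x^(-(m-1)d/2) h^(-i-1) u_i], which is
    periodic in [i].  The relation for [S(u_j) S(u_i)] follows from the
    effect of [x -> x^-1] on a product of consecutive factors [phi]
    ([Phi_inv]).  In the antipode axioms on [u_i] a character sum singles out
    one value of [p], and the remaining binomial vanishes unless [m] divides
    [i] ([antipodel_sum], [antipoder_sum]). *)

(** * Linear maps and unital algebras *)

Section LinearMaps.
Variables (R : pzRingType) (U V : lmodType R) (f : U -> V).
Hypothesis lf : linear f.

Lemma lin0 : f 0 = 0.
Proof. by have := lf (-1) 0 0; rewrite scaler0 addr0 scaleN1r addNr. Qed.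
Lemma linD u v : f (u + v) = f u + f v.
Proof. by rewrite -[u]scale1r lf !scale1r. Qed.
Lemma linZ c u : f (c *: u) = c *: f u.
Proof. by rewrite -[c *: u]addr0 lf lin0 addr0. Qed.
Lemma lin_sum I (r : seq I) (P : pred I) F :
  f (\sum_(i <- r | P i) F i) = \sum_(i <- r | P i) f (F i).
Proof. exact: (big_morph f linD lin0). Qed.
End LinearMaps.

Lemma eq_scale (k : pzRingType) (V : lmodType k) (c c' : k) (v v' : V) :
  c = c' -> v = v' -> c *: v = c' *: v'.
Proof. by move=> -> ->. Qed.

Lemma linear_comp (R : pzRingType) (U V W : lmodType R) (f : V -> W) (g : U -> V) :
  linear f -> linear g -> linear (f \o g).
Proof. by move=> lf lg c u v /=; rewrite lg lf. Qed.

Lemma linear_eq_submodule (R : pzRingType) (U V : lmodType R) (f g : U -> V) :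
  linear f -> linear g -> submodule (fun u => f u = g u).
Proof.
move=> lf lg; split; first by rewrite !lin0.
by move=> c u v eu ev; rewrite lf lg eu ev.
Qed.

(** A copy of [A] carrying a ring structure, so that [A] itself keeps only its
    unital algebra structure while products, powers and iterated operators are
    written in ring notation. *)
Definition uring (k : pzRingType) (A : ualgType k) : Type := A.

Section URing.
Variables (k : pzRingType) (A : ualgType k).
HB.instance Definition _ := GRing.Lmodule.on (uring A).

Fact uring_mulDl : left_distributive (@amul k A) +%R.
Proof. by move=> a b c; apply: (linD (amul_linearl c)). Qed.
Fact uring_mulDr : right_distributive (@amul k A) +%R.
Proof. by move=> a b c; apply: (linD (amul_linearr a)). Qed.

HB.instance Definition _ := GRing.Zmodule_isPzRing.Build (uring A)
  (@amulA k A) (@amul1l k A) (@amul1r k A) uring_mulDl uring_mulDr.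

End URing.

Section URingScale.
Variables (k : fieldType) (A : ualgType k).
Implicit Types a b : uring A.
Lemma uscaleAl (c : k) a b : (c *: a) * b = c *: (a * b).
Proof. exact: (linZ (amul_linearl b)). Qed.
Lemma uscaleAr (c : k) a b : a * (c *: b) = c *: (a * b).
Proof. exact: (linZ (amul_linearr a)). Qed.
End URingScale.

Definition alg_hom (k : pzRingType) (A B : ualgType k) (f : A -> B) : Prop :=
  [/\ linear f, f aone = aone & forall a b, f (a ** b) = f a ** f b].

Section AlgHom.
Variables (k : pzRingType) (A B : ualgType k) (f : A -> B).
Hypothesis hf : alg_hom f.
Local Notation f' := (f : uring A -> uring B).
Lemma hom_lin : linear f. Proof. by case: hf. Qed.
Lemma hom1 : f' 1 = 1. Proof. by case: hf. Qed.
Lemma homM a b : f' (a * b) = f' a * f' b.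
Proof. by case: hf => _ _; apply. Qed.
Lemma homX a n : f' (a ^+ n) = f' a ^+ n.
Proof. by elim: n => [|n IH]; rewrite ?hom1 // !exprS homM IH. Qed.
End AlgHom.

Lemma alg_hom_id (k : pzRingType) (A : ualgType k) : alg_hom (id : A -> A).
Proof. by split. Qed.

Lemma alg_hom_comp (k : pzRingType) (A B C : ualgType k) (f : B -> C) (g : A -> B) :
  alg_hom f -> alg_hom g -> alg_hom (f \o g).
Proof.
move=> [lf f1 fM] [lg g1 gM]; split; first exact: linear_comp.
  by rewrite /= g1 f1.
by move=> a b /=; rewrite gM fM.
Qed.

(** An anti-homomorphism of [A] is a homomorphism [A -> uop A], which lets the
    universal property of a presented algebra produce antipodes. *)
Definition uop (k : pzRingType) (A : ualgType k) : Type := A.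
Section Opposite.
Variables (k : pzRingType) (A : ualgType k).
HB.instance Definition _ := GRing.Lmodule.on (uop A).
Definition op_mul (a b : uop A) : uop A := (b : A) ** a.
Fact op_mulA : associative op_mul.
Proof. by move=> a b c; rewrite /op_mul amulA. Qed.
Fact op_mul1l : left_id (aone : A) op_mul.
Proof. by move=> a; apply: amul1r. Qed.
Fact op_mul1r : right_id (aone : A) op_mul.
Proof. by move=> a; apply: amul1l. Qed.
Fact op_linearl b : linear (op_mul^~ b).
Proof. exact: amul_linearr. Qed.
Fact op_linearr a : linear (op_mul a).
Proof. exact: amul_linearl. Qed.
HB.instance Definition _ := Lmodule_isUnitalAlgebra.Build k (uop A)
  op_mulA op_mul1l op_mul1r op_linearl op_linearr.

Lemma uop_exp (a : uring A) n : ((a : uring (uop A)) ^+ n) = a ^+ n.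
Proof. by elim: n => // n IH; rewrite exprS exprSr IH. Qed.
End Opposite.

(* A counit is a homomorphism to the ground field, here seen as an algebra
   over itself. *)
Section Ground.
Variable k : comNzRingType.
Fact ground_linearl (b : k^o) : linear (fun a : k^o => a * b : k^o).
Proof. by move=> c u v; rewrite mulrDl /GRing.scale /= mulrA. Qed.
Fact ground_linearr (a : k^o) : linear (fun b : k^o => a * b : k^o).
Proof. by move=> c u v; rewrite mulrDr /GRing.scale /= mulrCA. Qed.
HB.instance Definition _ := Lmodule_isUnitalAlgebra.Build k k^o
  (@mulrA k) (@mul1r k) (@mulr1 k) ground_linearl ground_linearr.
End Ground.

(** * Algebras given by generators and relations *)

Section FreeEval.
Variables (k : fieldType) (X : choiceType).
Local Notation F := {malg k[{fmonom X}]}.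

Lemma malg_ind (P : F -> Prop) : submodule P -> (forall p, P << p >>) -> forall z, P z.
Proof.
move=> [P0 PL] Pp z.
rewrite [z]monalgE; elim/big_ind: _ => // [u v Pu Pv|p _].
  by rewrite -[u]scale1r; apply: PL.
have -> : << z@_p *g p >> = z@_p *: << p >> :> F.
  by apply/malgP=> q; rewrite mcoeffZ !mcoeffU mulrnAr mulr1.
by have := PL z@_p _ _ (Pp p) P0; rewrite addr0.
Qed.

Variables (B : ualgType k) (f : X -> uring B).

Definition fm_eval (w : {fmonom X}) : uring B := \prod_(i <- (w : seq X)) f i.
Definition feval (a : F) : uring B := linext fm_eval a.

Lemma feval_lin : linear feval. Proof. exact: linext_linear. Qed.
Lemma feval_gen i : feval (free_gen k i) = f i.
Proof. by rewrite /feval linextU /fm_eval fmuE big_seq1. Qed.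
Lemma feval1 : feval 1 = 1.
Proof. by rewrite /feval linextU /fm_eval /= fm1 big_nil. Qed.
Lemma fevalM a b : feval (a * b) = feval a * feval b.
Proof.
have lm (c : uring B) : linear (fun d : uring B => c * d) by exact: (amul_linearr (c : B)).
have lm' (c : uring B) : linear (fun d : uring B => d * c) by exact: (amul_linearl (c : B)).
move: a; apply: malg_ind => [|p].
  apply: linear_eq_submodule => c u v.
    by rewrite mulrDl -scalerAl feval_lin.
  by rewrite feval_lin lm'.
move: b; apply: malg_ind => [|q].
  apply: linear_eq_submodule => c u v.
    by rewrite mulrDr -malg_scalerAr feval_lin.
  by rewrite feval_lin lm.
rewrite malgM_def fgmulUU mulr1 /feval !linextU /fm_eval.
by rewrite fmM big_cat.
Qed.
End FreeEval.

Section PresentedHom.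
Variables (k : fieldType) (X : choiceType).
Local Notation F := {malg k[{fmonom X}]}.
Variable rel : F -> F -> Prop.
Local Notation Q := (presented rel).
Local Notation pr := (presented_proj rel).

(** Words are spanned by left multiplication by generators, so a subspace
    containing 1 and stable under these is everything. *)
Lemma presented_proj_gen_ind (P : Q -> Prop) : submodule P -> P aone ->
  (forall i a, P a -> P (pr (free_gen k i) ** a)) -> forall a, P a.
Proof.
move=> sP P1 PM q; have [z ->] := qproj_surj q; move: z.
apply: malg_ind => [|p].
  split=> [|c u v Pu Pv].
    have [P0 _] := sP; rewrite (_ : qproj _ 0 = 0) //.
    exact: (lin0 (@presented_projL _ _ rel)).
  have [_ PL] := sP; rewrite (_ : qproj _ _ = c *: pr u + pr v); first exact: PL.
  exact: (@presented_projL _ _ rel).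
have -> : p = FMonom (p : seq X) by rewrite fmK.
elim: (p : seq X) => [|i w IH].
  by rewrite -fmoneE.
have -> : FMonom (i :: w) = mmul (fmu i) (FMonom w).
  by apply/eqP; rewrite fmP fmM fmuE.
have := PM i _ IH; rewrite -[X in P X -> _](presented_projM rel).
by rewrite malgM_def fgmulUU mulr1.
Qed.

(** Universal property: the evaluation of the free algebra kills the ideal
    generators [a * (l - r) * b], hence factors through the quotient. *)
Lemma presented_rec (B : ualgType k) (f : X -> uring B) :
  (forall l r, rel l r -> feval f l = feval f r) ->
  exists2 h : Q -> B, alg_hom h & forall a, h (pr a) = feval f a.
Proof.
move=> hf; pose h (q : Q) : B := feval f (qrepr q).
have hE a : h (pr a) = feval f a.
  apply: qrepr_lift; first exact: feval_lin.
  move=> _ [u l r v lr]; rewrite !fevalM (_ : feval f (l - r) = 0) ?mulr0 ?mul0r //.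
  by rewrite addrC -scaleN1r feval_lin scaleN1r (hf _ _ lr) addNr.
exists h => //; split.
- move=> c p q; have [a ->] := qproj_surj p; have [b ->] := qproj_surj q.
  have := hE (c *: a + b); rewrite feval_lin -!hE => <-.
  by rewrite /h presented_projL.
- by rewrite -[RHS](feval1 f) -hE.
- move=> p q; have [a ->] := qproj_surj p; have [b ->] := qproj_surj q.
  by rewrite -[X in h X](presented_projM rel) [LHS]hE fevalM -!hE.
Qed.
End PresentedHom.

(** * Tensor products of algebras *)

Section TensorHom.
Variable k : comNzRingType.
Implicit Types A B C : ualgType k.

Lemma pureM A B (a a' : A) (b b' : B) :
  pure a b ** pure a' b' = pure (a ** a') (b ** b').
Proof. exact: tens_mulE. Qed.

(** [pure] with values in the ring view of the tensor product; the coproduct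
    computations below are done for an arbitrary pairing, of which this is the
    instance that matters. *)
Definition upure A B (a : uring A) (b : uring B) : uring (tens A B) :=
  pure (a : A) (b : B).

Lemma upureM A B (a a' : uring A) (b b' : uring B) :
  upure a b * upure a' b' = upure (a * a') (b * b').
Proof. exact: tens_mulE. Qed.
Lemma upure1 A B : upure (1 : uring A) (1 : uring B) = 1.
Proof. by []. Qed.
Lemma alg_hom_tens_lift A B C (f : A -> B -> C) : Defs.bilinear f ->
  f aone aone = aone ->
  (forall a a' b b', f (a ** a') (b ** b') = f a b ** f a' b') ->
  alg_hom (tens_lift f).
Proof.
move=> bf f1 fM; have lf := tens_lift_linear bf; split=> //.
  by rewrite [LHS](tens_liftE _ _ bf) f1.
move=> s t; move: s; apply: eq_linear_tens => [c u v|c u v|a b].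
- by rewrite amul_linearl lf.
- by rewrite lf amul_linearl.
move: t; apply: eq_linear_tens => [c u v|c u v|a' b'].
- by rewrite amul_linearr lf.
- by rewrite lf amul_linearr.
by rewrite pureM !tens_liftE // fM.
Qed.

Lemma tens_map_bil (A B A' B' : lmodType k) (f : A -> A')
  (g : B -> B') : linear f -> linear g ->
  Defs.bilinear (fun a b => pure (f a) (g b)).
Proof.
have [pl pr] := pure_bilinear A' B'.
by move=> lf lg; split=> [b c a a'|a c b b']; rewrite (lf, lg) (pl, pr).
Qed.

Lemma tens_map_lin (A B A' B' : lmodType k) (f : A -> A') (g : B -> B') :
  linear f -> linear g -> linear (tens_map f g).
Proof. by move=> lf lg; apply: (tens_lift_linear (tens_map_bil lf lg)). Qed.

Lemma tens_mapE (A B A' B' : lmodType k) (f : A -> A')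
  (g : B -> B') a b : linear f -> linear g ->
  tens_map f g (pure a b) = pure (f a) (g b).
Proof. by move=> lf lg; apply: (tens_liftE a b (tens_map_bil lf lg)). Qed.

Lemma alg_hom_tens_map A B A' B' (f : A -> A') (g : B -> B') :
  alg_hom f -> alg_hom g -> alg_hom (tens_map f g).
Proof.
move=> [lf f1 fM] [lg g1 gM]; apply: alg_hom_tens_lift.
- exact: tens_map_bil.
- by rewrite f1 g1.
by move=> a a' b b'; rewrite fM gM pureM.
Qed.

Section Assoc.
Variables A B C : lmodType k.

Definition assoc_at (c : C) : tens A B -> tens A (tens B C) :=
  tens_lift (fun a b => pure a (pure b c)).

Lemma assoc_inner_bil (c : C) : Defs.bilinear (fun (a : A) (b : B) => pure a (pure b c)).
Proof.
split=> [b e a a'|a e b b'].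
  exact: (pure_bilinear A (tens B C)).1.
rewrite ((pure_bilinear B C).1 c e b b').
exact: (pure_bilinear A (tens B C)).2.
Qed.
Lemma assoc_atE c a b : assoc_at c (pure a b) = pure a (pure b c).
Proof. exact: (tens_liftE a b (assoc_inner_bil c)). Qed.
Lemma assoc_at_lin c : linear (assoc_at c).
Proof. exact: (tens_lift_linear (assoc_inner_bil c)). Qed.
Lemma assoc_at_bil : Defs.bilinear (fun (t : tens A B) (c : C) => assoc_at c t).
Proof.
split=> [c|t e c c']; first exact: assoc_at_lin.
move: t; apply: eq_linear_tens => [||a b].
- exact: assoc_at_lin.
- by apply: linear_comb; apply: assoc_at_lin.
rewrite !assoc_atE ((pure_bilinear B C).2 b e c c').
exact: (pure_bilinear A (tens B C)).2.
Qed.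

Lemma tens_assoc_pure t c : tens_assoc (pure t c) = assoc_at c t.
Proof. exact: (tens_liftE _ _ assoc_at_bil). Qed.

Lemma tens_assoc_lin : linear (@tens_assoc k A B C).
Proof. exact: (tens_lift_linear assoc_at_bil). Qed.
End Assoc.

(* Stated for an abstract trilinear map, so that the associator is never
   unfolded in the proof of multiplicativity. *)
Section TrilinearLift.
Variables (A B C M : ualgType k) (f : A -> B -> C -> M).
Hypotheses (f_bil : forall c, Defs.bilinear (fun a b => f a b c))
  (f_lin : forall a b, linear (f a b)).
Hypotheses (f1 : f aone aone aone = aone)
  (fM : forall a b c a' b' c',
     f (a ** a') (b ** b') (c ** c') = f a b c ** f a' b' c').

Let asc c : tens A B -> M := tens_lift (fun a b => f a b c).
Let ascE c a b : asc c (pure a b) = f a b c.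
Proof. exact: (tens_liftE a b (f_bil c)). Qed.
Let asc_lin c : linear (asc c).
Proof. exact: (tens_lift_linear (f_bil c)). Qed.

Lemma alg_hom_tens_lift3 : alg_hom (tens_lift (fun t c => asc c t)).
Proof.
apply: alg_hom_tens_lift.
- split=> [c|t e c c']; first exact: asc_lin.
  move: t; apply: eq_linear_tens => [||a b].
  + exact: asc_lin.
  + by apply: linear_comb; apply: asc_lin.
  by rewrite !ascE f_lin.
- by rewrite [LHS]ascE f1.
move=> s t c c'; move: s; apply: eq_linear_tens => [||a b].
- exact: (linear_comp (asc_lin (c ** c')) (amul_linearl t)).
- exact: (linear_comp (amul_linearl (asc c' t)) (asc_lin c)).
move: t; apply: eq_linear_tens => [||a' b'].
- exact: (linear_comp (asc_lin (c ** c')) (amul_linearr (pure a b))).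
- exact: (linear_comp (amul_linearr (asc c (pure a b))) (asc_lin c')).
by rewrite pureM !ascE fM.
Qed.
End TrilinearLift.

Lemma alg_hom_tens_assoc A B C : alg_hom (@tens_assoc k A B C).
Proof.
apply: (@alg_hom_tens_lift3 A B C (tens A (tens B C))
  (fun a b c => pure a (pure b c))) => //.
- exact: assoc_inner_bil.
- move=> a b; exact: (linear_comp ((pure_bilinear A (tens B C)).2 a)
  ((pure_bilinear B C).2 b)).
by move=> *; rewrite !pureM.
Qed.

Section CounitMaps.
Variables (A : ualgType k) (e : A -> k^o).
Hypothesis he : alg_hom e.
Lemma counitl_bil : Defs.bilinear (fun x y : A => e x *: y).
Proof.
have le := hom_lin he.
split=> [y c x x'|x c y y']; last by rewrite scalerDr !scalerA mulrC.
by rewrite le scalerDl -scalerA.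
Qed.
Lemma counitr_bil : Defs.bilinear (fun x y : A => e y *: x).
Proof. by have [l r] := counitl_bil; split=> [y|x]; [apply: r | apply: l]. Qed.
Lemma alg_hom_counitl : alg_hom (tens_lift (fun x y : A => e x *: y)).
Proof.
have [_ e1 eM] := he.
apply: alg_hom_tens_lift => [||a a' b b']; first exact: counitl_bil.
  by rewrite e1 scale1r.
by rewrite eM (linZ (amul_linearl _)) (linZ (amul_linearr _)) scalerA.
Qed.
Lemma alg_hom_counitr : alg_hom (tens_lift (fun x y : A => e y *: x)).
Proof.
have [_ e1 eM] := he.
apply: alg_hom_tens_lift => [||a a' b b']; first exact: counitr_bil.
  by rewrite e1 scale1r.
by rewrite eM (linZ (amul_linearl _)) (linZ (amul_linearr _)) scalerA.
Qed.
End CounitMaps.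

(** * Antipode identities and products *)

Section Convolution.
Variables (A : ualgType k) (D : A -> tens A A) (e : A -> k^o) (S : A -> A).
Hypotheses (hD : alg_hom D) (he : alg_hom e) (hS : alg_hom (S : A -> uop A)).

Let lS : linear S. Proof. exact: hom_lin hS. Qed.
Let SM a b : S (a ** b) = S b ** S a. Proof. by case: hS => _ _; apply. Qed.

Lemma antil_bil : Defs.bilinear (fun x y : A => S x ** y).
Proof. by split=> [y c x x'|x c y y']; rewrite ?lS ?(amul_linearl, amul_linearr). Qed.
Lemma antir_bil : Defs.bilinear (fun x y : A => x ** S y).
Proof. by split=> [y c x x'|x c y y']; rewrite ?lS ?(amul_linearl, amul_linearr). Qed.

(** The antipode identities at one element; they are not equalities of algebra
    maps, so their propagation from generators to products is a separate
    argument. *)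
Definition antil_at a := tens_lift (fun x y => S x ** y) (D a) = e a *: aone.
Definition antir_at a := tens_lift (fun x y => x ** S y) (D a) = e a *: aone.

Lemma antil_submodule : submodule antil_at.
Proof.
apply: linear_eq_submodule.
  by apply: linear_comp; [apply: tens_lift_linear antil_bil | apply: hom_lin].
by move=> c u v; rewrite (hom_lin he) scalerDl -scalerA.
Qed.
Lemma antir_submodule : submodule antir_at.
Proof.
apply: linear_eq_submodule.
  by apply: linear_comp; [apply: tens_lift_linear antir_bil | apply: hom_lin].
by move=> c u v; rewrite (hom_lin he) scalerDl -scalerA.
Qed.

Lemma antil1 : antil_at aone.
Proof.
have [_ D1 _] := hD; have [_ e1 _] := he; have [_ S1 _] := hS.
by rewrite /antil_at D1 e1 scale1r [LHS](tens_liftE _ _ antil_bil) S1 [LHS]amul1l.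
Qed.
Lemma antir1 : antir_at aone.
Proof.
have [_ D1 _] := hD; have [_ e1 _] := he; have [_ S1 _] := hS.
by rewrite /antir_at D1 e1 scale1r [LHS](tens_liftE _ _ antir_bil) S1 [LHS]amul1l.
Qed.

(** In [S(a1 b1) a2 b2 = S(b1) (S(a1) a2) b2] the inner factor sums to the
    scalar [e a], which leaves [e a] times the identity for [b]. *)
Lemma antilM a b : antil_at a -> antil_at b -> antil_at (a ** b).
Proof.
rewrite /antil_at => ha hb; have [_ _ DM] := hD; have [_ _ eM] := he.
have ll := tens_lift_linear antil_bil.
have key t : tens_lift (fun x y => S x ** y) (D a ** t) =
             e a *: tens_lift (fun x y => S x ** y) t.
  move: t; apply: eq_linear_tens => [c u v|c u v|b1 b2].
  - by rewrite amul_linearr ll.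
  - by rewrite ll scalerDr !scalerA mulrC.
  rewrite (tens_liftE _ _ antil_bil).
  have -> : e a *: (S b1 ** b2) = S b1 ** tens_lift (fun x y => S x ** y) (D a) ** b2.
    by rewrite ha (linZ (amul_linearr _)) (linZ (amul_linearl _)) amul1r.
  move: (D a); apply: eq_linear_tens => [c u v|c u v|a1 a2].
  - by rewrite amul_linearl ll.
  - by rewrite ll amul_linearr amul_linearl.
  by rewrite pureM !(tens_liftE _ _ antil_bil) SM !amulA.
by rewrite DM key hb eM scalerA.
Qed.

(** Symmetrically, [a1 b1 S(a2 b2) = a1 (b1 S(b2)) S(a2)]. *)
Lemma antirM a b : antir_at a -> antir_at b -> antir_at (a ** b).
Proof.
rewrite /antir_at => ha hb; have [_ _ DM] := hD; have [_ _ eM] := he.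
have ll := tens_lift_linear antir_bil.
have key t : tens_lift (fun x y => x ** S y) (t ** D b) =
             e b *: tens_lift (fun x y => x ** S y) t.
  move: t; apply: eq_linear_tens => [c u v|c u v|a1 a2].
  - by rewrite amul_linearl ll.
  - by rewrite ll scalerDr !scalerA mulrC.
  rewrite (tens_liftE _ _ antir_bil).
  have -> : e b *: (a1 ** S a2) = a1 ** tens_lift (fun x y => x ** S y) (D b) ** S a2.
    by rewrite hb (linZ (amul_linearr _)) (linZ (amul_linearl _)) amul1r.
  move: (D b); apply: eq_linear_tens => [c u v|c u v|b1 b2].
  - by rewrite amul_linearr ll.
  - by rewrite ll amul_linearr amul_linearl.
  by rewrite pureM !(tens_liftE _ _ antir_bil) SM !amulA.
by rewrite DM key ha eM scalerA mulrC.
Qed.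
End Convolution.
End TensorHom.

(** * Gaussian binomials *)

Section QBinomial.
Variables (k : fieldType) (q : k).

(** [qbin r p] is the Gaussian binomial of [r + p] over [r].  Indexed by the two
    complementary parts, Pascal's rule has no truncated subtraction and the
    binomial is defined for every [q], including roots of unity, where the
    quotient of factorials is not. *)
Fixpoint qbin (r : nat) : nat -> k :=
  if r is r'.+1 then
    fix qbin_r p := if p is p'.+1 then qbin r' p + q ^+ r * qbin_r p' else 1
  else fun=> 1.

Lemma qbin0n p : qbin 0 p = 1. Proof. by []. Qed.
Lemma qbinn0 r : qbin r 0 = 1. Proof. by case: r. Qed.
Lemma qbinSS r p : qbin r.+1 p.+1 = qbin r p.+1 + q ^+ r.+1 * qbin r.+1 p.
Proof. by []. Qed.

Local Arguments qbin : simpl never.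

Definition qnum n : k := \sum_(i < n) q ^+ i.
Definition qfact n : k := \prod_(i < n) qnum i.+1.

Lemma qnumD r p : qnum (r + p) = qnum r + q ^+ r * qnum p.
Proof.
rewrite /qnum big_split_ord /= mulr_sumr; congr (_ + _).
by apply: eq_bigr => i _; rewrite exprD.
Qed.

Lemma qfactS n : qfact n.+1 = qfact n * qnum n.+1.
Proof. by rewrite /qfact big_ord_recr. Qed.

(** The splitting [qnumD] of the last factor of the factorial on the right
    matches the two terms of Pascal's rule. *)
Lemma qbin_fact r p : qbin r p * (qfact r * qfact p) = qfact (r + p).
Proof.
elim: r p => [|r IHr] p; first by rewrite qbin0n /qfact big_ord0 !mul1r.
elim: p => [|p IHp]; first by rewrite qbinn0 /qfact big_ord0 mulr1 mul1r addn0.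
have -> : qbin r.+1 p.+1 * (qfact r.+1 * qfact p.+1) =
    qbin r p.+1 * (qfact r * qfact p.+1) * qnum r.+1 +
    q ^+ r.+1 * (qbin r.+1 p * (qfact r.+1 * qfact p)) * qnum p.+1.
  by rewrite qbinSS (qfactS r) (qfactS p); ring.
by rewrite IHr IHp !addSn addnS [RHS]qfactS -addSn -addnS qnumD; ring.
Qed.

Variables (A : ualgType k) (a b : uring A).
Hypothesis ba : b * a = q *: (a * b).

Lemma qcommX r : b * a ^+ r = q ^+ r *: (a ^+ r * b).
Proof.
elim: r => [|r IH]; first by rewrite !expr0 mulr1 mul1r scale1r.
rewrite exprS mulrA ba uscaleAl -mulrA IH uscaleAr scalerA mulrA.
by rewrite -!exprS.
Qed.

(** The [q]-binomial theorem.  In the tensor square it expands the powers of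
    [Delta(y)], the sum of two elements that commute up to [gamma]. *)
Lemma qbinomial n :
  (a + b) ^+ n = \sum_(r < n.+1) qbin r (n - r) *: (a ^+ r * b ^+ (n - r)).
Proof.
elim: n => [|n IH]; first by rewrite big_ord1 !expr0 mulr1 scale1r.
rewrite exprS IH mulrDl !mulr_sumr.
rewrite [RHS]big_ord_recl subn0 expr0 mul1r scale1r.
rewrite big_ord_recr [X in _ + X]big_ord_recl /= !subn0 subnn expr0 mul1r mulr1 !scale1r.
rewrite qbinn0 scale1r -!exprS [LHS]addrCA; congr (_ + _).
rewrite [RHS]big_ord_recr /= subnn qbinn0 scale1r expr0 mulr1 addrC addrA; congr (_ + _).
rewrite -big_split /=; apply: eq_bigr => i _.
rewrite /bump /= !add1n subSS.
have -> : (n - i = (n - i.+1).+1)%N by rewrite subnSK.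
rewrite qbinSS scalerDl !uscaleAr addrC; congr (_ *: _ + _).
  by rewrite mulrA -exprS.
by rewrite mulrA qcommX uscaleAl scalerA -mulrA -exprS mulrC.
Qed.
End QBinomial.
Arguments qbin : simpl never.

(** * Powers of the root of unity *)

Section Roots.
Variables (k : fieldType) (m : nat) (xi : k).
Hypotheses (m0 : (0 < m)%N) (xi_prim : (2 * m).-primitive_root xi).

(** All scalars of the problem except [1/m] are powers of [xi]; written with an
    integer exponent, equalities between them become congruences modulo [2 m]
    of integer polynomials.  The root [gamma] is [xp 2]. *)
Definition xp (z : int) : k := xi ^ z.

Lemma xi_neq0 : xi != 0.
Proof.
apply/eqP => z; have := prim_expr_order xi_prim.
by rewrite z expr0n muln_eq0 /= (gtn_eqF m0) => /eqP; rewrite eq_sym oner_eq0.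
Qed.
Lemma xp0 : xp 0 = 1. Proof. by []. Qed.
Lemma xpD a b : xp (a + b) = xp a * xp b.
Proof. by apply: expfzDr; apply: xi_neq0. Qed.
Lemma xpX a n : xp a ^+ n = xp (a * n%:Z).
Proof. exact: (exprz_exp xi a n). Qed.
Lemma xpZ a b : xp a ^ b = xp (a * b).
Proof. by rewrite /xp exprz_exp. Qed.
Lemma xpV a : (xp a)^-1 = xp (- a).
Proof. by rewrite /xp invr_expz. Qed.
Lemma xiX n : xi ^+ n = xp n%:Z. Proof. by []. Qed.

Lemma xp_eq1 a : (xp a == 1) = (2 * m%:Z %| a)%Z.
Proof.
have H n : (xp n%:Z == 1) = (2 * m%:Z %| n%:Z)%Z.
  have -> : xp n%:Z = xi ^+ n by [].
  by rewrite -(prim_order_dvd xi_prim) -PoszM.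
case: a => n; first exact: H.
by rewrite NegzE -xpV invr_eq1 H !dvdzE abszN.
Qed.

(** The multiple [c] of the period is passed explicitly: with it, the equality
    of exponents is a polynomial identity. *)
Lemma xp_mod a b c : a = b + 2 * m%:Z * c -> xp a = xp b.
Proof.
move=> ->; rewrite xpD (_ : xp (_ * c) = 1) ?mulr1 //.
by apply/eqP; rewrite xp_eq1 dvdz_mulr.
Qed.

(** The sign [xi ^ (m j)] is what makes [xi ^ (j * j + m j)], the scalar of the
    relation for [u_i u_j], depend on [j] modulo [m] only: shifting [j] by
    [m c] adds [m * m * c (c + 1)] modulo [2 m], and [c (c + 1)] is even. *)
Lemma xp_sq_period j c :
  xp ((j + m%:Z * c) * (j + m%:Z * c) + m%:Z * (j + m%:Z * c)) =
  xp (j * j + m%:Z * j).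
Proof.
have e2 : (2 %| c * (c + 1))%Z.
  by rewrite dvdzE abszM /= dvdn2 oddM; case: c => n /=; lia.
(* The exponents differ by [2 m j c + m m c (c + 1)]. *)
apply: (@xp_mod _ _ (j * c + m%:Z * (c * (c + 1) %/ 2)%Z)).
move/divzK: e2; move: (_ %/ _)%Z => h hE.
transitivity (j * j + m%:Z * j + 2 * m%:Z * (j * c) + m%:Z * m%:Z * (h * 2)).
  by rewrite hE; ring.
by ring.
Qed.

Lemma xpm : xp m%:Z = -1.
Proof.
have : xp m%:Z ^+ 2 == 1 by rewrite xpX xp_eq1 mulrC.
rewrite sqrf_eq1 xp_eq1 => /orP[|/eqP //].
by rewrite -PoszM dvdzE !absz_nat gtnNdvd // ltn_Pmull.
Qed.

Lemma sgn_xp n : (-1) ^+ n = xp (m%:Z * n%:Z).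
Proof. by rewrite -xpX xpm. Qed.

Local Notation gamma := (xp 2).
Local Notation B := (qbin gamma).

Lemma gamma_eq1 n : (gamma ^+ n == 1) = (m %| n)%N.
Proof. by rewrite xpX xp_eq1 dvdz_mul2l. Qed.

Lemma qnum_gamma n : (0 < n < m)%N -> qnum gamma n != 0.
Proof.
move=> /andP[n0 nm]; apply/eqP => H.
have := subrX1 gamma n; rewrite -/(qnum _ _) H mulr0 => /eqP.
rewrite subr_eq0 gamma_eq1; apply/negP; rewrite gtnNdvd //.
Qed.

Lemma qnum_gamma_m : (1 < m)%N -> qnum gamma m = 0.
Proof.
move=> m1; have /eqP := subrX1 gamma m; rewrite -/(qnum _ _).
have -> : gamma ^+ m = 1 by apply/eqP; rewrite gamma_eq1.
rewrite subrr eq_sym mulf_eq0 subr_eq0 -(expr1 gamma) gamma_eq1 dvdn1.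
by case: eqP => [e|_ /eqP //]; rewrite e in m1.
Qed.

Lemma qfact_neq0 n : (n < m)%N -> qfact gamma n != 0.
Proof.
elim: n => [|n IH] nm; first by rewrite /qfact big_ord0 oner_neq0.
by rewrite qfactS mulf_neq0 ?IH ?qnum_gamma //; apply: ltnW.
Qed.

Lemma qfact_eq0 n : (1 < m)%N -> (m <= n)%N -> qfact gamma n = 0.
Proof.
move=> m1; elim: n => [|n IH]; first by rewrite leqNgt m0.
rewrite leq_eqVlt ltnS qfactS => /orP[/eqP <-|/IH ->]; last by rewrite mul0r.
by rewrite qnum_gamma_m // mulr0.
Qed.

(** The factorial of [r + p] contains the zero factor [qnum m], those of [r] and
    of [p] do not. *)
Lemma qbin_eq0 r p : (r < m)%N -> (p < m)%N -> (m <= r + p)%N -> B r p = 0.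
Proof.
move=> rltm pm mrp; have m1 : (1 < m)%N by lia.
have /eqP := qbin_fact gamma r p; rewrite (qfact_eq0 m1 mrp) !mulf_eq0.
by rewrite (negPf (qfact_neq0 rltm)) (negPf (qfact_neq0 pm)) !orbF => /eqP.
Qed.

(** Both sides are [(r+s+p)! (r+p)! / (r! p! s! (r+p)!)]; the bound keeps every
    factorial invertible. *)
Lemma qbin_trinomial r s p : (r + s + p < m)%N ->
  B r p * B s (r + p) = B r s * B (r + s) p.
Proof.
move=> lt.
have nz n : (n <= r + s + p)%N -> qfact gamma n != 0.
  by move=> le; apply: qfact_neq0; apply: leq_ltn_trans lt.
have nzr : qfact gamma r != 0 by apply: nz; lia.
have nzs : qfact gamma s != 0 by apply: nz; lia.
have nzp : qfact gamma p != 0 by apply: nz; lia.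
have nzrp : qfact gamma (r + p) != 0 by apply: nz; lia.
have nzrs : qfact gamma (r + s) != 0 by apply: nz; lia.
have E a b : qfact gamma a != 0 -> qfact gamma b != 0 ->
    B a b = qfact gamma (a + b) / (qfact gamma a * qfact gamma b).
  by move=> na nb; rewrite -qbin_fact mulfK // mulf_neq0.
rewrite !E // addnCA addnA; field.
by rewrite nzr nzs nzp nzrp nzrs.
Qed.

(** Orthogonality of the characters of the integers modulo [m]. *)
Lemma gamma_sum (c : int) :
  \sum_(j < m) xp (2 * c * j%:Z) = if (m%:Z %| c)%Z then m%:R else 0.
Proof.
have -> : \sum_(j < m) xp (2 * c * j%:Z) = \sum_(j < m) xp (2 * c) ^+ j.
  by apply: eq_bigr => j _; rewrite xpX.
have E : (xp (2 * c) == 1) = (m%:Z %| c)%Z by rewrite xp_eq1 dvdz_mul2l.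
case: ifP => H.
  move: H; rewrite -E => /eqP->; rewrite (eq_bigr (fun=> 1)) => [|i _].
    by rewrite sumr_const card_ord.
  by rewrite expr1n.
have /eqP := subrX1 (xp (2 * c)) m.
have -> : xp (2 * c) ^+ m = 1.
  by rewrite xpX; apply/eqP; rewrite xp_eq1 mulrAC dvdz_mulr.
by rewrite subrr eq_sym mulf_eq0 subr_eq0 E H => /eqP.
Qed.

(** * Products of consecutive factors phi *)

Section Phi.
Variables (A : ualgType k) (X : uring A).

Definition phi1 (a : int) : uring A := 1 - xp (- (2 * (a + 1))) *: X.
Definition Phi (a : int) n : uring A := \prod_(l < n) phi1 (a + l%:Z).

Lemma phi1m a : phi1 (a + m%:Z) = phi1 a.
Proof. by rewrite /phi1 (@xp_mod _ (- (2 * (a + 1))) (-1)) //; lia. Qed.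

Lemma PhiSr a n : Phi a n.+1 = Phi a n * phi1 (a + n%:Z).
Proof. by rewrite /Phi big_ord_recr. Qed.
Lemma PhiSl a n : Phi a n.+1 = phi1 a * Phi (a + 1) n.
Proof.
rewrite /Phi big_ord_recl addr0; congr (_ * _); apply: eq_bigr => i _.
by congr phi1; rewrite /bump /= PoszD addrA.
Qed.
Lemma PhiD a n n' : Phi a (n + n') = Phi a n * Phi (a + n%:Z) n'.
Proof.
by rewrite /Phi big_split_ord; congr (_ * _); apply: eq_bigr => i _ /=; rewrite PoszD addrA.
Qed.

(** The expansion of the product of [m - 1 - r] consecutive factors starting at
    [a], by [Phi_sum]; the index [r] is the exponent of [y] that goes with this
    product in [u_i u_j]. *)
Definition Phis (a : int) (r : nat) : uring A :=
  \sum_(p < m) (B r p * xp (- (2 * a * p%:Z))) *: X ^+ p.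

(** The [q]-binomial theorem for the product gives coefficients
    [binom(n, p) (-1)^p ...], and at a root of unity of order [m] these are the
    binomials of [m - n - 1 + p] over [p] up to a power of [gamma].  Here the
    two are related by induction on [n]: multiplying by one more factor undoes
    one step of Pascal's rule.  The induction starts at [n = 0], where all
    binomials with [p > 0] vanish. *)
Lemma Phi_sum a n : (n < m)%N -> Phi a n = Phis a (m - n.+1).
Proof.
rewrite /Phis; have B0 := qbin_eq0; have xpmod := xp_mod.
move: m0 B0 xpmod; case: m => // m' _ B0 xpmod.
elim: n => [|n IH] nm.
  rewrite /Phi big_ord0 big_ord_recl big1 ?addr0; last first.
    move=> i _; rewrite B0 ?mul0r ?scale0r //=; have := ltn_ord i; rewrite /bump; lia.
  by rewrite qbinn0 mulr0 oppr0 xp0 mulr1 scale1r.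
rewrite PhiSr IH; last exact: ltnW.
have -> : (m'.+1 - n.+1 = (m'.+1 - n.+2).+1)%N by lia.
have [r rE] : {r | r = (m'.+1 - n.+2)%N} by eexists.
rewrite -rE.
rewrite /phi1 mulrBr mulr1 [X in _ - X * _]big_ord_recr /= B0 ?mul0r ?scale0r ?addr0;
  [|lia..].
rewrite [X in X - _]big_ord_recl [RHS]big_ord_recl !qbinn0 -addrA; congr (_ + _).
rewrite mulr_suml -sumrB; apply: eq_bigr => i _.
rewrite uscaleAl uscaleAr scalerA -exprSr -scalerBl; congr (_ *: _).
rewrite qbinSS mulrDl -[RHS]addr0 -addrA; congr (_ + _).
apply/eqP; rewrite subr_eq0; apply/eqP.
rewrite xpX (mulrC (xp _) (B _ _)) -!mulrA -!xpD; congr (_ * _).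
apply: (@xpmod _ _ 1).
have -> : n%:Z = m'%:Z - 1 - r%:Z by lia.
have e: i.+1%:Z = i%:Z + 1 by lia.
have e': m'.+1%:Z = m'%:Z + 1 by lia.
have e'': r.+1%:Z = r%:Z + 1 by lia.
rewrite e e' e''; ring.
Qed.
End Phi.
End Roots.

(** * Integer powers, residues and periodic functions *)

Section FevalMorph.
Variables (k : fieldType) (X : choiceType) (B : ualgType k) (f : X -> uring B).
Local Notation F := {malg k[{fmonom X}]}.
Lemma fevalB a b : feval f (a - b) = feval f a - feval f b.
Proof. by rewrite addrC -scaleN1r feval_lin scaleN1r addrC. Qed.
Lemma fevalX a n : feval f (a ^+ n) = feval f a ^+ n.
Proof. by elim: n => [|n IH]; rewrite ?feval1 // !exprS fevalM IH. Qed.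
Lemma feval_prod I (r : seq I) (P : pred I) (G : I -> F) :
  feval f (\prod_(i <- r | P i) G i) = \prod_(i <- r | P i) feval f (G i).
Proof. exact: (big_morph (feval f) (fevalM f) (feval1 f)). Qed.
Lemma fevalZ c a : feval f (c *: a) = c *: feval f a.
Proof. exact: (linZ (feval_lin f)). Qed.
End FevalMorph.

Section OneParam.
Variables (k : pzRingType) (A : ualgType k).
Implicit Types (F G : int -> uring A) (c s : uring A).

(** Families such as [x ^ a], [g ^ b] or their scalar twists, indexed by the
    integers: identities for all exponents follow from the exponent 1. *)
Definition one_param F := F 0 = 1 /\ forall a b, F (a + b) = F a * F b.

(** Commutation with a generator propagates to its integer powers; negative
    exponents follow by cancelling on both sides. *)
Lemma twist F G c : one_param F -> one_param G -> c * F 1 = G 1 * c ->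
  forall a, c * F a = G a * c.
Proof.
move=> [F0 FD] [G0 GD] c1.
have P n : c * F n%:Z = G n%:Z * c.
  elim: n => [|n IH]; first by rewrite F0 G0 mulr1 mul1r.
  by rewrite -addn1 PoszD FD GD mulrA IH -!mulrA c1.
case=> n //; rewrite NegzE.
rewrite -[c in LHS]mul1r -[1]G0 -(addNr n.+1%:Z) GD -!mulrA.
by rewrite [X in _ * X]mulrA -P -!mulrA -FD subrr F0 mulr1.
Qed.

Lemma one_param_eq F G : one_param F -> one_param G -> F 1 = G 1 -> F =1 G.
Proof.
move=> hF hG e a; rewrite -[F a]mul1r -[G a]mulr1.
by apply: twist => //; rewrite mul1r mulr1.
Qed.

(** The power of exponent [z], given an inverse [s'] of [s]; it has the shape of
    [fxz] in the relations. *)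
Definition zp s s' (z : int) : uring A :=
  match z with Posz p => s ^+ p | Negz p => s' ^+ p.+1 end.

Lemma zp_one_param s s' : s * s' = 1 -> s' * s = 1 -> one_param (zp s s').
Proof.
move=> ss' s's; split=> //.
have D1 a : zp s s' (a + 1) = zp s s' a * s.
  case: a => [n|n]; first by rewrite -PoszD addn1 -exprSr.
  rewrite /= exprSr -mulrA s's mulr1.
  by case: n => [|n] //; rewrite (_ : Negz n.+1 + 1 = Negz n) //; lia.
have DN1 a : zp s s' (a - 1) = zp s s' a * s'.
  by rewrite -{2}(subrK 1 a) D1 -mulrA ss' mulr1.
move=> a [n|n].
  elim: n => [|n IH]; first by rewrite addr0 mulr1.
  by rewrite -addn1 PoszD addrA D1 IH -mulrA /= -exprSr addn1.
elim: n => [|n IH]; first exact: DN1.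
have -> : a + Negz n.+1 = a + Negz n - 1 by lia.
by rewrite DN1 IH -mulrA /= -exprSr.
Qed.

Lemma zp_opp s s' z : s * s' = 1 -> s' * s = 1 -> zp s' s z = zp s s' (- z).
Proof.
move=> ss' s's; have [z0 zD] := zp_one_param ss' s's.
refine (@one_param_eq (zp s' s) (fun z => zp s s' (- z)) _ _ _ z) => //.
  exact: zp_one_param.
by split=> // a b; rewrite opprD zD.
Qed.
End OneParam.

Section IntMod.
Variable m : nat.
Hypothesis m0 : (0 < m)%N.

Definition resm (z : int) : nat := `|(z %% m%:Z)%Z|%N.

Lemma resm_lt z : (resm z < m)%N.
Proof. by rewrite /resm; have := ltz_pmod z (d := m%:Z); have := modz_ge0 z (d := m%:Z);
  lia. Qed.
Lemma resmE z : {c | (resm z)%:Z = z + m%:Z * c}.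
Proof.
exists (- (z %/ m%:Z)%Z).
have := divz_eq z m; have := @modz_ge0 z m%:Z; rewrite /resm; lia.
Qed.
Lemma resmD z c : resm (z + m%:Z * c) = resm z.
Proof. by rewrite /resm mulrC addrC modzMDl. Qed.
Lemma resmDm z : resm (z + m%:Z) = resm z.
Proof. by rewrite -{1}[m%:Z]mulr1 resmD. Qed.
Lemma resm_small i : (i < m)%N -> resm i%:Z = i.
Proof. by move=> im; rewrite /resm modz_small //. Qed.
Lemma resm_eq0 z : (resm z == 0)%N = (m%:Z %| z)%Z.
Proof. by rewrite /resm absz_eq0; apply/eqP/dvdz_mod0P. Qed.

Definition ordz (z : int) : 'I_m := Ordinal (resm_lt z).

Section Periodic.
Variables (V : nmodType) (F : int -> V).
Hypothesis FP : forall z, F (z + m%:Z) = F z.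

Lemma per_mul z c : F (z + m%:Z * c) = F z.
Proof.
have P n y : F (y + m%:Z * n%:Z) = F y.
  elim: n => [|n IH]; first by rewrite mulr0 addr0.
  by rewrite -addn1 PoszD mulrDr mulr1 addrA FP.
case: c => n; first exact: P.
by rewrite -[LHS](P n.+1); congr F; rewrite NegzE; ring.
Qed.
Lemma per_resm z : F (resm z)%:Z = F z.
Proof. by have [c ->] := resmE z; rewrite per_mul. Qed.

(** Translation by [c] permutes the residues modulo [m].  This is the reindexing
    used in all coproduct sums. *)
Lemma sum_shift c : \sum_(j < m) F (j%:Z + c) = \sum_(j < m) F j%:Z.
Proof.
rewrite [RHS](reindex (fun j : 'I_m => ordz (j%:Z + c))).
  by apply: eq_bigr => j _; rewrite per_resm.
exists (fun j : 'I_m => ordz (j%:Z - c)) => j _; apply: val_inj => /=.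
  have [e ->] := resmE (j%:Z + c).
  by rewrite addrAC addrK resmD resm_small.
have [e ->] := resmE (j%:Z - c).
by rewrite addrAC subrK resmD resm_small.
Qed.
End Periodic.
End IntMod.

(** * The relations, with integer indices *)

(** The canonical projection is the evaluation at its own generators, so that
    relations and values in the presented algebra are read off by the same
    evaluation lemmas as in any other target. *)
Lemma feval_proj (k : fieldType) (X : choiceType)
    (rel : {malg k[{fmonom X}]} -> {malg k[{fmonom X}]} -> Prop) a :
  feval (fun i => presented_proj rel (free_gen k i) : uring (presented rel)) a =
  presented_proj rel a.
Proof.
have pl := @presented_projL _ _ rel.
move: a; apply: malg_ind => [|p].
  by apply: linear_eq_submodule; [apply: feval_lin | apply: pl].
rewrite /feval linextU /fm_eval.
have -> : p = FMonom (p : seq X) by rewrite fmK.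
elim: (p : seq X) => [|i w IH]; first by rewrite big_nil -fmoneE.
have -> : FMonom (i :: w) = mmul (fmu i) (FMonom w).
  by apply/eqP; rewrite fmP fmM fmuE.
rewrite fmM fmuE [LHS]big_cons [X in _ * X = _]IH.
apply: etrans (esym (presented_projM rel _ _)) _.
by rewrite malgM_def fgmulUU mulr1 -fmuE.
Qed.

Lemma half2 n : (2 * (n * (n + 1))./2%:Z = n%:Z * n%:Z + n%:Z)%R.
Proof.
have : (((n * (n + 1))./2).*2 = n * (n + 1))%N.
  by rewrite even_halfK // oddM oddD; case: odd.
move: (_./2) => h; lia.
Qed.

Section Laws.
Variables (k : fieldType) (m d : nat) (xi : k).
Hypotheses (m0 : (0 < m)%N) (xi_prim : (2 * m).-primitive_root xi).
Local Notation xp := (xp xi).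
Local Notation B := (qbin (xp 2)).
Local Notation e := (((1 + m) * d)./2).

(** The defining relations, for elements of an arbitrary algebra.  The family
    [u] is indexed periodically by the integers, and [Phis] with the residue of
    [i + j] replaces the three cases of [P_ij]; [laws_rel] and [rel_laws] show
    that this is the same set of relations. *)
Record Dlaws (A : ualgType k) (x x' g g' y : uring A) (u : int -> uring A) : Prop :=
  DLaws {
  Lxx' : x * x' = 1;
  Lx'x : x' * x = 1;
  Lgg' : g * g' = 1;
  Lg'g : g' * g = 1;
  Lxg : x * g = g * x;
  Lxy : x * y = y * x;
  Lyg : y * g = xp 2 *: (g * y);
  Lym : y ^+ m = 1 - x ^+ (m * d);
  Lgm : g ^+ m = x ^+ (m * d);
  Lum i : u (i + m%:Z) = u i;
  Lxu i : x * u i = u i * x';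
  Lyu i : y * u i = phi1 xi (x ^+ d) i * u (i + 1);
  Luy i : y * u i = xi *: (x ^+ d * u i * y);
  Lug i : u i * g = xp (2 * i) *: (zp x x' (- (2 * d)%N%:Z) * g * u i);
  Luu i j : u i * u j = (m%:R^-1 * xp (j * j + m%:Z * j)) *:
     (zp x x' (- e%:Z) * Phis m xi (x ^+ d) i (resm m (i + j)) * y ^+ resm m (i + j) * g)
}.

Section Eval.
Variables (A : ualgType k) (f : D_gen m -> uring A) (u : int -> uring A).
Hypothesis um : forall i, u (i + m%:Z) = u i.
Hypothesis fu_u : forall i : 'I_m, f (Gu i) = u i%:Z.
Let X := f Gx ^+ d.

Lemma feval_fx : feval f (fx k m) = f Gx. Proof. exact: feval_gen. Qed.
Lemma feval_fxinv : feval f (fxinv k m) = f Gxinv. Proof. exact: feval_gen. Qed.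
Lemma feval_fg : feval f (fg k m) = f Gg. Proof. exact: feval_gen. Qed.
Lemma feval_fginv : feval f (fginv k m) = f Gginv. Proof. exact: feval_gen. Qed.
Lemma feval_fy : feval f (fy k m) = f Gy. Proof. exact: feval_gen. Qed.
Lemma feval_fu (i : 'I_m) : feval f (fu k i) = u i%:Z.
Proof. by rewrite -fu_u; apply: feval_gen. Qed.
Lemma feval_fuS (i : 'I_m) : feval f (fu k (ordS i)) = u (i%:Z + 1).
Proof.
rewrite feval_fu -(per_resm m0 um) -[RHS](per_resm m0 um); congr (u _%:Z).
by rewrite /= -modz_nat /resm modz_mod -addn1 PoszD.
Qed.
Lemma feval_fxz z : feval f (fxz k m z) = zp (f Gx) (f Gxinv) z.
Proof. by case: z => n; rewrite /fxz /zp fevalX (feval_fx, feval_fxinv). Qed.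

Lemma evM a b v w : feval f a = v -> feval f b = w -> feval f (a * b) = v * w.
Proof. by move=> <- <-; apply: fevalM. Qed.
Lemma evB a b v w : feval f a = v -> feval f b = w -> feval f (a - b) = v - w.
Proof. by move=> <- <-; apply: fevalB. Qed.
Lemma evZ c a v : feval f a = v -> feval f (c *: a) = c *: v.
Proof. by move=> <-; apply: fevalZ. Qed.
Lemma evX a v n : feval f a = v -> feval f (a ^+ n) = v ^+ n.
Proof. by move=> <-; apply: fevalX. Qed.

Lemma ev_rel l r v w : feval f l = v -> feval f r = w ->
  v = w -> feval f l = feval f r.
Proof. by move=> <- <-. Qed.
Lemma ev_val l r v w : feval f l = v -> feval f r = w ->
  feval f l = feval f r -> v = w.
Proof. by move=> <- <-. Qed.

Lemma feval_phi z : feval f (phi m d xi z) = phi1 xi X z.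
Proof.
apply: etrans (evB (feval1 f) (evZ _ (evX d feval_fx))) _.
congr (_ - _ *: _); apply: etrans (xpZ xi 2 _) _.
by congr xp; ring.
Qed.

Lemma feval_prod_phi a b : feval f (\prod_(a <= l < b) phi m d xi l%:Z) =
  Phi xi X a%:Z (b - a).
Proof.
rewrite feval_prod /Phi -{1}[a]add0n big_addn big_mkord.
by apply: eq_bigr => i _; rewrite feval_phi addnC PoszD.
Qed.

(** In the third case the factors [phi_i, ..., phi_(m-1)] and
    [phi_0, ..., phi_(m-2-j)] are consecutive modulo [m]; in the middle case the
    product is empty. *)
Lemma feval_P (i j : 'I_m) : feval f (P_ m d xi i j) =
  Phis m xi X i%:Z (resm m (i%:Z + j%:Z)) * f Gy ^+ resm m (i%:Z + j%:Z).
Proof.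
have im := ltn_ord i; have jm := ltn_ord j.
have rE : resm m (i%:Z + j%:Z) = ((i + j) %% m)%N by rewrite -PoszD /resm modz_nat.
rewrite rE /P_; case: ltnP => ij.
  rewrite fevalM fevalX feval_fy feval_prod_phi modn_small; last lia.
  rewrite (Phi_sum m0 xi_prim); last lia.
  by congr (Phis _ _ _ _ _ * _); lia.
case: eqP => ij'.
  rewrite fevalX feval_fy modn_small; last lia.
  have := Phi_sum m0 xi_prim X i%:Z (n := 0) m0; rewrite /Phi big_ord0 => E.
  by rewrite -[LHS]mul1r E ij' subn1.
rewrite !fevalM fevalX feval_fy !feval_prod_phi.
have -> : ((i + j) %% m = i + j - m)%N.
  have mij : (m <= i + j)%N by lia.
  by rewrite -{1}(subnK mij) modnDr modn_small //; lia.
congr (_ * _); rewrite subn0.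
have -> : Phi xi X 0 (m - 1 - j) = Phi xi X (i%:Z + (m - i)%N%:Z) (m - 1 - j).
  apply: eq_bigr => l _; have -> : i%:Z + (m - i)%N%:Z + l%:Z = 0 + l%:Z + m%:Z by lia.
  by rewrite (phi1m m0 xi_prim).
rewrite -PhiD (Phi_sum m0 xi_prim); last lia.
by congr Phis; lia.
Qed.

Lemma uu_scalar (j : nat) : (-1) ^- j * xi ^- j * (xi ^+ 2) ^+ (j * (j + 1))./2 * m%:R^-1
  = m%:R^-1 * xp (j%:Z * j%:Z + m%:Z * j%:Z).
Proof.
rewrite mulrC; congr (_ * _).
rewrite (sgn_xp m0 xi_prim) !(xiX xi) !xpV xpX half2 -!(xpD m0 xi_prim).
by apply: (xp_mod m0 xi_prim (c := - j%:Z)); ring.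
Qed.

(* Evaluates an expression of the free algebra by following its syntax; the
   value is an existential variable determined on the way. *)
Ltac ev := lazymatch goal with
  | |- feval _ (_ * _) = _ => apply: evM; ev
  | |- feval _ (_ - _) = _ => apply: evB; ev
  | |- feval _ (_ *: _) = _ => apply: evZ; ev
  | |- feval _ (_ ^+ _) = _ => apply: evX; ev
  | |- feval _ 1 = _ => exact: feval1
  | |- feval _ (fx _ _) = _ => exact: feval_fx
  | |- feval _ (fxinv _ _) = _ => exact: feval_fxinv
  | |- feval _ (fg _ _) = _ => exact: feval_fg
  | |- feval _ (fginv _ _) = _ => exact: feval_fginv
  | |- feval _ (fy _ _) = _ => exact: feval_fy
  | |- feval _ (fu _ (ordS _)) = _ => exact: feval_fuS
  | |- feval _ (fu _ _) = _ => exact: feval_fu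
  | |- feval _ (fxz _ _ _) = _ => exact: feval_fxz
  | |- feval _ (phi _ _ _ _) = _ => exact: feval_phi
  | |- feval _ (P_ _ _ _ _ _) = _ => exact: feval_P
  end.

Lemma laws_rel : Dlaws (f Gx) (f Gxinv) (f Gg) (f Gginv) (f Gy) u ->
  forall l r, D_rel d xi l r -> feval f l = feval f r.
Proof.
move=> L l r [].
- by eapply ev_rel; [ev|ev|exact: (Lxx' L)].
- by eapply ev_rel; [ev|ev|exact: (Lx'x L)].
- by eapply ev_rel; [ev|ev|exact: (Lgg' L)].
- by eapply ev_rel; [ev|ev|exact: (Lg'g L)].
- by eapply ev_rel; [ev|ev|exact: (Lxg L)].
- by eapply ev_rel; [ev|ev|exact: (Lxy L)].
- by eapply ev_rel; [ev|ev|exact: (Lyg L)].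
- by eapply ev_rel; [ev|ev|exact: (Lym L)].
- by eapply ev_rel; [ev|ev|rewrite (Lgm L)].
- by move=> i; eapply ev_rel; [ev|ev|exact: (Lxu L)].
- by move=> i; eapply ev_rel; [ev|ev|exact: (Lyu L)].
- by move=> i; eapply ev_rel; [ev|ev|rewrite -(Lyu L); exact: (Luy L)].
- by move=> i; eapply ev_rel; [ev|ev|rewrite (Lug L) !(xiX xi) xpX].
- by move=> i j; eapply ev_rel; [ev|ev|rewrite uu_scalar (Luu L) !mulrA].
Qed.

Lemma rel_laws : (forall l r, D_rel d xi l r -> feval f l = feval f r) ->
  Dlaws (f Gx) (f Gxinv) (f Gg) (f Gginv) (f Gy) u.
Proof.
move=> H.
have uE i : u i = u (ordz m0 i)%:Z by rewrite /= per_resm.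
have uE1 i : u (i + 1) = u ((ordz m0 i)%:Z + 1).
  by have [c E] := resmE m0 i; rewrite /= E addrAC per_mul.
have phiE i : phi1 xi X i = phi1 xi X (ordz m0 i)%:Z.
  by have [c E] := resmE m0 i; rewrite /= E (per_mul (phi1m m0 xi_prim X)).
split=> //.
- by refine (ev_val _ _ (H _ _ (D_xxinv m d xi))); ev.
- by refine (ev_val _ _ (H _ _ (D_xinvx m d xi))); ev.
- by refine (ev_val _ _ (H _ _ (D_gginv m d xi))); ev.
- by refine (ev_val _ _ (H _ _ (D_ginvg m d xi))); ev.
- by refine (ev_val _ _ (H _ _ (D_xg m d xi))); ev.
- by refine (ev_val _ _ (H _ _ (D_xy m d xi))); ev.
- by refine (ev_val _ _ (H _ _ (D_yg m d xi))); ev.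
- by refine (ev_val _ _ (H _ _ (D_ym_x m d xi))); ev.
- have : 1 - f Gx ^+ (m * d) = 1 - f Gg ^+ m.
    by refine (ev_val _ _ (H _ _ (D_ym_g m d xi))); ev.
  by move/addrI/oppr_inj.
- move=> i; rewrite uE.
  by refine (ev_val _ _ (H _ _ (D_xu d xi (ordz m0 i)))); ev.
- move=> i; rewrite uE uE1 phiE.
  by refine (ev_val _ _ (H _ _ (D_yu_phi d xi (ordz m0 i)))); ev.
- move=> i; rewrite uE.
  have E := H _ _ (D_yu_phi d xi (ordz m0 i)).
  by refine (ev_val _ _ (etrans E (H _ _ (D_yu_uy d xi (ordz m0 i))))); ev.
- move=> i; have : u (ordz m0 i)%:Z * f Gg =
     (xi ^+ 2) ^+ resm m i *: (zp (f Gx) (f Gxinv) (- (2 * d)%N%:Z) * f Gg * u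
       (ordz m0 i)%:Z).
    by refine (ev_val _ _ (H _ _ (D_ug d xi (ordz m0 i)))); ev.
  rewrite -uE => ->; congr (_ *: _).
  rewrite !(xiX xi) !xpX; have [c E] := resmE m0 i; rewrite E.
  by apply: (xp_mod m0 xi_prim (c := c)); ring.
move=> i j; have := H _ _ (D_uu d xi (ordz m0 i) (ordz m0 j)).
set l := _ * _; set r := _ *: _ => lr.
have El : feval f l = u i * u j by rewrite uE (uE j) /l; ev.
rewrite -El lr {l El lr}.
eapply etrans; first by rewrite /r; ev.
rewrite uu_scalar /=.
have [c E] := resmE m0 i; have [c' E'] := resmE m0 j.
have -> : resm m ((resm m i)%:Z + (resm m j)%:Z) = resm m (i + j).
  by rewrite E E' addrACA -mulrDr resmD.
have -> : Phis m xi X (resm m i)%:Z (resm m (i + j)) = Phis m xi X i (resm m (i + j)).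
  apply: eq_bigr => p _; congr (_ * _ *: _).
  by rewrite E; apply: (xp_mod m0 xi_prim (c := - c * p%:Z)); ring.
have -> : xp ((resm m j)%:Z * (resm m j)%:Z + m%:Z * (resm m j)%:Z) = xp (j * j + m%:Z * j).
  by rewrite E' (xp_sq_period m0 xi_prim).
by rewrite !mulrA.
Qed.
End Eval.
End Laws.

(** * Normal forms *)

(** The monomial [x^a g^b].  It is locked so that comparing two monomials means
    comparing their integer exponents, never unfolding powers. *)
HB.lock Definition gmon (k : fieldType) (A : ualgType k) (x x' g g' : uring A)
  (a b : int) : uring A := zp x x' a * zp g g' b.

Section Theory.
Variables (k : fieldType) (m d : nat) (xi : k).
Hypotheses (m0 : (0 < m)%N) (xi_prim : (2 * m).-primitive_root xi).
Local Notation xp := (xp xi).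
Local Notation B := (qbin (xp 2)).
Local Notation e := (((1 + m) * d)./2).
Let xpD := xpD m0 xi_prim.

Variables (A : ualgType k) (x x' g g' y : uring A) (u : int -> uring A).
Hypothesis L : Dlaws m d xi x x' g g' y u.

Local Notation T := (gmon x x' g g').
Lemma gmonE a b : T a b = zp x x' a * zp g g' b. Proof. by rewrite gmon.unlock. Qed.

Lemma zp_1 (s s' : uring A) : zp s s' 1 = s. Proof. exact: expr1. Qed.
Lemma px : one_param (zp x x').
Proof. exact: zp_one_param (Lxx' L) (Lx'x L). Qed.
Lemma pg : one_param (zp g g').
Proof. exact: zp_one_param (Lgg' L) (Lg'g L). Qed.

Lemma zp_comm a b : zp g g' b * zp x x' a = zp x x' a * zp g g' b.
Proof.
apply: (twist px px); apply/esym/(twist pg pg).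
by rewrite !zp_1 (Lxg L).
Qed.

Lemma gmonM a b a' b' : T a b * T a' b' = T (a + a') (b + b').
Proof.
have [_ xD] := px; have [_ gD] := pg.
by rewrite !gmonE xD gD !mulrA; congr (_ * _); rewrite -!mulrA zp_comm.
Qed.
Lemma gmon0 : T 0 0 = 1. Proof. by rewrite !gmonE mulr1. Qed.
Lemma gmonX a b n : T a b ^+ n = T (a * n%:Z) (b * n%:Z).
Proof.
elim: n => [|n IH]; first by rewrite !mulr0 gmon0.
rewrite exprS IH gmonM -addn1 PoszD.
by congr (T _ _); rewrite mulrDr mulr1 addrC.
Qed.
Lemma gmon_x : x = T 1 0. Proof. by rewrite !gmonE mulr1 zp_1. Qed.
Lemma gmon_x' : x' = T (- 1) 0. Proof. by rewrite !gmonE mulr1. Qed.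
Lemma gmon_g : g = T 0 1. Proof. by rewrite !gmonE mul1r zp_1. Qed.
Lemma gmon_g' : g' = T 0 (- 1). Proof. by rewrite !gmonE mul1r. Qed.
Lemma gmon_zpx a : zp x x' a = T a 0. Proof. by rewrite !gmonE mulr1. Qed.
Lemma gmon_zpxg a : zp x x' a * g = T a 1. Proof. by rewrite gmonE zp_1. Qed.
Lemma gmon_xX n : x ^+ n = T n%:Z 0. Proof. by rewrite -gmon_zpx. Qed.

(** The relation [g ^ m = x ^ (m d)], for all integer exponents. *)
Lemma gmon_period a b c : T a (b + m%:Z * c) = T (a + (m * d)%N%:Z * c) b.
Proof.
have [x0 xD] := px; have [g0 gD] := pg.
have E : zp g g' (m%:Z * c) = zp x x' ((m * d)%N%:Z * c).
  apply: (@one_param_eq _ _ (fun c => zp g g' (m%:Z * c))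
                        (fun c => zp x x' ((m * d)%N%:Z * c))).
  - by split=> [|a' b']; rewrite ?mulr0 // mulrDr gD.
  - by split=> [|a' b']; rewrite ?mulr0 // mulrDr xD.
  by rewrite !mulr1; apply: (Lgm L).
by rewrite !gmonE xD gD E zp_comm mulrA.
Qed.

Lemma gmon_gX n : g ^+ n = T 0 n%:Z. Proof. by rewrite !gmonE mul1r. Qed.

Lemma y_gmon r a b : y ^+ r * T a b = xp (2 * r%:Z * b) *: (T a b * y ^+ r).
Proof.
have [g0 gD] := pg.
have yx : y ^+ r * zp x x' a = zp x x' a * y ^+ r.
  apply: (twist px px); rewrite !zp_1.
  elim: r => [|r IH]; first by rewrite mulr1 mul1r.
  by rewrite exprS -mulrA IH !mulrA (Lxy L).
rewrite !gmonE mulrA yx -!(mulrA (zp x x' a)) -uscaleAr; congr (_ * _).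
rewrite -uscaleAl.
refine (@twist _ _ (zp g g') (fun b => xp (2 * r%:Z * b) *: zp g g' b) _ pg _ _ b).
  split=> [|b1 b2]; first by rewrite mulr0 scale1r.
  by rewrite gD mulrDr xpD uscaleAl uscaleAr scalerA.
rewrite !zp_1 mulr1 uscaleAl; elim: r {yx} => [|r IH].
  by rewrite mulr1 mul1r scale1r.
rewrite exprS -mulrA IH uscaleAr mulrA (Lyg L) uscaleAl scalerA -!mulrA; congr (_ *: _).
by rewrite -xpD; congr xp; lia.
Qed.

(** Moving [u] past [x] inverts it, and past [g] costs [gamma^i x^(-2d)]; the
    factors [x^(-2d)] accumulate to [x^(-2db)]. *)
Lemma u_gmon i a b : u i * T a b = xp (2 * i * b) *: (T (- a - 2 * d%:Z * b) b * u i).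
Proof.
have [x0 xD] := px; have [g0 gD] := pg.
have ux : u i * zp x x' a = zp x x' (- a) * u i.
  refine (@twist _ _ (zp x x') (fun a => zp x x' (- a)) _ px _ _ a).
    by split=> // a1 a2; rewrite opprD xD.
  rewrite zp_1 (_ : zp x x' (- 1) = x') //.
  rewrite -[LHS]mul1r -(Lx'x L) -!mulrA; congr (_ * _).
  by rewrite mulrA (Lxu L) -mulrA (Lx'x L) mulr1.
have ug : u i * zp g g' b = (xp (2 * i * b) *: T (- (2 * d%:Z * b)) b) * u i.
  refine (@twist _ _ (zp g g') (fun b => xp (2 * i * b) *: T (- (2 * d%:Z * b)) b)
    _ pg _ _ b).
    split=> [|b1 b2]; first by rewrite !mulr0 oppr0 gmon0 scale1r.
    rewrite uscaleAl uscaleAr gmonM scalerA -xpD; congr (xp _ *: T _ _); ring.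
  rewrite zp_1 (Lug L) uscaleAl !mulr1.
  by rewrite gmon_zpxg PoszM.
rewrite (gmonE a b) mulrA ux -mulrA ug uscaleAl uscaleAr mulrA gmon_zpx gmonM add0r.
by [].
Qed.

Lemma yg r : y ^+ r * g = xp (2 * r%:Z) *: (T 0 1 * y ^+ r).
Proof. by have := y_gmon r 0 1; rewrite -gmon_g mulr1. Qed.

Lemma yuE i : y * u i = u (i + 1) - xp (- (2 * (i + 1))) *: (T d%:Z 0 * u (i + 1)).
Proof. by rewrite (Lyu L) /phi1 mulrBl mul1r uscaleAl gmon_xX. Qed.

Lemma uyE i : u i * y = xp (- 1) *: (T (- d%:Z) 0 * (y * u i)).
Proof.
rewrite (Luy L) uscaleAr scalerA -[xi]/(xp 1) -xpD scale1r.
by rewrite gmon_xX !mulrA gmonM addNr addr0 gmon0 mul1r.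
Qed.

(** The product of two [u]'s as a combination of monomials in [x], [g], [y]: the
    form in which character sums can be applied. *)
Lemma uuE i j : u i * u j = \sum_(p < m)
  (m%:R^-1 * xp (j * j + m%:Z * j + 2 * (i + j) - 2 * i * p%:Z) *
     B (resm m (i + j)) p) *:
  (T (d%:Z * p%:Z - e%:Z) 1 * y ^+ resm m (i + j)).
Proof.
rewrite (Luu L) /Phis mulr_sumr !mulr_suml scaler_sumr; apply: eq_bigr => p _.
rewrite uscaleAr !uscaleAl scalerA gmon_xX gmon_zpx gmonX gmonM.
rewrite -(mulrA (T _ _)) yg uscaleAr (mulrA (T _ _)) gmonM scalerA;
  congr (_ *: (T _ _ * _)); last by lia.
  transitivity (m%:R^-1 * (xp (j * j + m%:Z * j) * xp (- (2 * i * p%:Z))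
      * xp (2 * (resm m (i + j))%:Z)) * B (resm m (i + j)) p); first by ring.
  rewrite -!xpD; congr (_ * _ * _).
  have [c ->] := resmE m0 (i + j).
  by apply: (xp_mod m0 xi_prim (c := c)); ring.
Qed.
End Theory.

(** * The coproduct *)

Section Coproduct.
Variables (k : fieldType) (m d : nat) (xi : k).
Hypotheses (m0 : (0 < m)%N) (xi_prim : (2 * m).-primitive_root xi).
Local Notation xp := (xp xi).
Local Notation B := (qbin (xp 2)).
Local Notation e := (((1 + m) * d)./2).
Let xpD := xpD m0 xi_prim.

(** The identity of coefficients behind the relation for
    [Delta(u_i) Delta(u_j)].  For [r <= n] it is the trinomial identity, or both
    sides vanish.  For [n < r] the residue of [n - r] is [n - r + m], and the second binomial
    on the left is over [n + p + m], hence zero. *)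
Lemma qbin_coproduct n r p : (n < m)%N -> (r < m)%N -> (p < m)%N ->
  B r p * (if (r + p < m)%N then B (resm m (n%:Z - r%:Z)) (r + p) else 0) =
  if (r <= n)%N then B r (n - r) * B n p else 0.
Proof.
move=> nm rm' pm; case: ltnP => rp; last first.
  rewrite mulr0; case: leqP => // rn.
  by rewrite (@qbin_eq0 _ _ _ m0 xi_prim n p) ?mulr0 //; lia.
case: leqP => rn.
  have -> : resm m (n%:Z - r%:Z) = (n - r)%N by rewrite subzn // resm_small //; lia.
  have [lt|ge] := ltnP (n + p) m.
    rewrite (qbin_trinomial m0 xi_prim); last by lia.
    by congr (_ * B _ _); lia.
  rewrite (@qbin_eq0 _ _ _ m0 xi_prim (n - r) (r + p)) ?mulr0 //; [|lia..].
  by rewrite (@qbin_eq0 _ _ _ m0 xi_prim n p) ?mulr0.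
have -> : resm m (n%:Z - r%:Z) = (n + m - r)%N.
  rewrite -(resmDm m) (_ : n%:Z - r%:Z + m%:Z = (n + m - r)%N%:Z); last by lia.
  by rewrite resm_small //; lia.
by rewrite (@qbin_eq0 _ _ _ m0 xi_prim (n + m - r)) ?mulr0 //; lia.
Qed.

Variables (A : ualgType k) (x x' g g' y : uring A) (u : int -> uring A).
Hypothesis L : Dlaws m d xi x x' g g' y u.
Local Notation T := (gmon x x' g g').

(* The pairing [t] stands for the pure tensors; an abstract bilinear and
   multiplicative [t] keeps the quotient construction of the tensor product
   out of the computation. *)
Variables (C : ualgType k) (t : uring A -> uring A -> uring C).
Local Notation TT := (uring C).
Hypothesis t_bil : Defs.bilinear (t : A -> A -> C).
Hypothesis t1 : t 1 1 = 1.
Hypothesis tM : forall a b a' b', t a b * t a' b' = t (a * a') (b * b').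

Let tDl a a' b : t (a + a') b = t a b + t a' b.
Proof. exact: (linD (t_bil.1 b)). Qed.
Let tDr a b b' : t a (b + b') = t a b + t a b'.
Proof. exact: (linD (t_bil.2 a)). Qed.
Let tZl (c : k) a b : t (c *: a) b = c *: t a b.
Proof. exact: (linZ (t_bil.1 b)). Qed.
Let tZr (c : k) a b : t a (c *: b) = c *: t a b.
Proof. exact: (linZ (t_bil.2 a)). Qed.
Let tBl a a' b : t (a - a') b = t a b - t a' b.
Proof. by rewrite -scaleN1r tDl tZl scaleN1r. Qed.
Let tBr a b b' : t a (b - b') = t a b - t a b'.
Proof. by rewrite -scaleN1r tDr tZr scaleN1r. Qed.
Let t_suml I (r : seq I) (P : pred I) F b :
  t (\sum_(i <- r | P i) F i) b = \sum_(i <- r | P i) t (F i) b.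
Proof. exact: (lin_sum (t_bil.1 b)). Qed.
Let t_sumr I (r : seq I) (P : pred I) F a :
  t a (\sum_(i <- r | P i) F i) = \sum_(i <- r | P i) t a (F i).
Proof. exact: (lin_sum (t_bil.2 a)). Qed.
Let tX a b n : t a b ^+ n = t (a ^+ n) (b ^+ n).
Proof. by elim: n => [|n IH]; rewrite ?t1 // !exprS IH tM. Qed.

(** The power of [h = x^(-d) g] that multiplies the second factor of
    [Delta(u_i)].  Since [h ^ m = 1], it is periodic in [j], so the sum over [j]
    can be shifted. *)
Definition hpow (j : int) : uring A := T (- (j * d%:Z)) j.

Lemma hpow_period j : hpow (j + m%:Z) = hpow j.
Proof.
rewrite /hpow -{2}[m%:Z]mulr1 (gmon_period L).
by congr (gmon _ _ _ _ _ _); rewrite PoszM; ring.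
Qed.

Definition cop_u_term (i j : int) : TT :=
  xp (2 * (j * (i - j))) *: t (u j) (hpow j * u (i - j)).

Lemma cop_u_term_period i j : cop_u_term i (j + m%:Z) = cop_u_term i j.
Proof.
rewrite /cop_u_term hpow_period (Lum L).
have -> : u (i - (j + m%:Z)) = u (i - j) by rewrite -(Lum L); congr u; ring.
by apply: eq_scale => //; apply: (xp_mod m0 xi_prim (c := i - 2 * j - m%:Z)); ring.
Qed.

Definition cop_u (i : int) : TT := \sum_(j < m) cop_u_term i j%:Z.

Lemma cop_u_period i : cop_u (i + m%:Z) = cop_u i.
Proof.
apply: eq_bigr => j _; rewrite /cop_u_term.
have -> : u (i + m%:Z - j%:Z) = u (i - j%:Z) by rewrite addrAC (Lum L).
by apply: eq_scale => //; apply: (xp_mod m0 xi_prim (c := j%:Z)); ring.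
Qed.

Definition cop_y : TT := t y g + t 1 y.

Lemma t_zp (c c' : uring A) z :
  zp (t c c : TT) (t c' c') z = t (zp c c' z) (zp c c' z).
Proof. by case: z => n; rewrite /zp tX. Qed.

Let X := x ^+ d.
Let XT : X = T d%:Z 0. Proof. exact: (gmon_xX x x' g g' d). Qed.

Lemma X_hpow j : X * hpow j = T (d%:Z - j * d%:Z) j.
Proof. by rewrite XT (gmonM L) add0r. Qed.

(* The right-hand side of both relations between [y] and [u], in the form
   to which the two left-hand sides are reduced below. *)
Lemma phi_cop_u i : phi1 xi (t x x ^+ d : TT) i * cop_u (i + 1) =
  \sum_(j < m) (xp (2 * (j%:Z * (i + 1 - j%:Z))) *: t (u j%:Z) (hpow j%:Z * u
    (i + 1 - j%:Z))
   - xp (2 * (j%:Z * (i + 1 - j%:Z)) - 2 * (i + 1)) *: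
       t (X * u j%:Z) (X * hpow j%:Z * u (i + 1 - j%:Z))).
Proof.
rewrite /cop_u mulr_sumr; apply: eq_bigr => j _.
rewrite /phi1 mulrBl mul1r; congr (_ - _).
rewrite uscaleAl uscaleAr scalerA tX tM (mulrA (x ^+ d) (hpow _)) -xpD.
by apply: eq_scale => //; congr xp; ring.
Qed.

Lemma hpow_X j : hpow j * X = X * hpow j.
Proof. by rewrite X_hpow XT (gmonM L) addr0 addrC. Qed.
Lemma y_hpow j : y * hpow j = xp (2 * j) *: (hpow j * y).
Proof. by have := y_gmon m0 xi_prim L 1 (- (j * d%:Z)) j; rewrite mulr1. Qed.
Lemma yu_pred j : y * u (j - 1) = u j - xp (- (2 * j)) *: (X * u j).
Proof. by rewrite (yuE L) subrK -XT. Qed.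

Lemma yu_shift i j : y * u (i - j) = u (i + 1 - j) - xp (- (2 * (i + 1 - j))) *: (X * u
  (i + 1 - j)).
Proof. by rewrite -yu_pred; congr (_ * u _); ring. Qed.

(** Shifting [j] in the part coming from [y (x) g] aligns it with the part from
    [1 (x) y].  Each part is a difference of two terms, since [y u_j] is; the
    inner terms [P2] cancel and the outer ones, [P1] and [P3], make up
    [phi_i u_(i+1)]. *)
Lemma cop_y_mul_u i : cop_y * cop_u i = phi1 xi (t x x ^+ d : TT) i * cop_u (i + 1).
Proof.
rewrite phi_cop_u /cop_u mulr_sumr.
pose F (j : int) : TT := t y g * cop_u_term i (j - 1).
rewrite (eq_bigr (fun j : 'I_m => F (j%:Z + 1) + t 1 y * cop_u_term i j%:Z)); last first.
  by move=> j _; rewrite /F addrK mulrDl.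
have SF : \sum_(j < m) F (j%:Z + 1) = \sum_(j < m) F j%:Z.
  by apply: (sum_shift m0) => j; rewrite /F addrAC cop_u_term_period.
rewrite big_split SF -big_split; apply: eq_bigr => j _; move: (j%:Z) => {}j.
set P1 := t (u j) (hpow j * _); set P3 := t (X * _) _.
pose P2 := t (u j) (X * hpow j * u (i + 1 - j)).
have e1 : F j = xp (2 * ((j - 1) * (i + 1 - j))) *: (P2 - xp (- (2 * j)) *: P3).
  rewrite /F /cop_u_term (_ : i - (j - 1) = i + 1 - j); last by ring.
  rewrite uscaleAr tM yu_pred tBl tZl (mulrA g).
  have -> // : g * hpow (j - 1) = X * hpow j.
  rewrite X_hpow {1}(gmon_g x x' g g') (gmonM L).
  by congr (gmon _ _ _ _ _ _); ring.
have e2 : t 1 y * cop_u_term i j = xp (2 * (j * (i - j)) + 2 * j) *: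
    (P1 - xp (- (2 * (i + 1 - j))) *: P2).
  rewrite /cop_u_term uscaleAr tM mul1r (mulrA y) y_hpow uscaleAl tZr scalerA -xpD.
  by rewrite -(mulrA (hpow j)) yu_shift (mulrBr (hpow j)) tBr uscaleAr tZr (mulrA
    (hpow j)) hpow_X.
rewrite e1 e2 !scalerBr !scalerA -!xpD [LHS]addrC [LHS]addrA.
rewrite (_ : xp (2 * ((j - 1) * (i + 1 - j))) =
             xp (2 * (j * (i - j)) + 2 * j + - (2 * (i + 1 - j)))); last first.
  by congr xp; ring.
rewrite subrK; by congr (_ - _); apply: eq_scale => //; congr xp; ring.
Qed.

(** The same telescoping as for the left multiplication by [y], with cancelling
    terms [P4]. *)
Lemma cop_u_mul_y i : xi *: (t x x ^+ d * cop_u i * cop_y) = phi1 xi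
  (t x x ^+ d : TT) i * cop_u (i + 1).
Proof.
rewrite phi_cop_u /cop_u mulr_sumr mulr_suml scaler_sumr tX -/X.
have uyX j : xi *: (X * u j * y) = y * u j by rewrite (Luy L).
pose F (j : int) : TT := xi *: (t X X * cop_u_term i (j - 1) * t y g).
rewrite (eq_bigr (fun j : 'I_m => F (j%:Z + 1) + xi *:
  (t X X * cop_u_term i j%:Z * t 1 y))); last first.
  by move=> j _; rewrite /F addrK mulrDr scalerDr.
have SF : \sum_(j < m) F (j%:Z + 1) = \sum_(j < m) F j%:Z.
  by apply: (sum_shift m0) => j; rewrite /F addrAC cop_u_term_period.
rewrite big_split SF -big_split; apply: eq_bigr => j _; move: (j%:Z) => {}j.
set P1 := t (u j) (hpow j * _); set P3 := t (X * _) _.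
pose P4 := t (X * u j) (hpow j * u (i + 1 - j)).
have e1 : F j = xp (2 * (j * (i + 1 - j))) *: (P1 - xp (- (2 * j)) *: P4).
  rewrite /F /cop_u_term (_ : i - (j - 1) = i + 1 - j); last by ring.
  rewrite !uscaleAr !uscaleAl !tM scalerA (mulrC xi) -scalerA -tZl uyX yu_pred.
  have -> : X * (hpow (j - 1) * u (i + 1 - j)) * g = xp (2 * (i + 1 - j)) *: (hpow j * u
    (i + 1 - j)).
    rewrite -!mulrA (_ : u _ * g = u (i + 1 - j) * T 0 1);
      last by rewrite -(gmon_g x x' g g').
    rewrite (u_gmon m0 xi_prim L) !uscaleAr mulr1 !mulrA X_hpow (gmonM L).
    by apply: eq_scale => //; congr (gmon _ _ _ _ _ _ * _); ring.
  rewrite tZr scalerA -xpD tBl tZl.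
  by apply: eq_scale => //; congr xp; ring.
have e2 : xi *: (t X X * cop_u_term i j * t 1 y) = xp (2 * (j * (i - j))) *:
    (P4 - xp (- (2 * (i + 1 - j))) *: P3).
  rewrite /cop_u_term !uscaleAr !uscaleAl !tM mulr1 scalerA (mulrC xi) -scalerA -tZr.
  rewrite [X * (hpow j * _)]mulrA -hpow_X -!(mulrA (hpow j)) -uscaleAr uyX.
  by rewrite yu_shift (mulrBr (hpow j)) tBr uscaleAr tZr (mulrA (hpow j)) hpow_X.
rewrite e1 e2 !scalerBr !scalerA -!xpD.
rewrite (_ : xp (2 * (j * (i - j))) =
   xp (2 * (j * (i + 1 - j)) - 2 * j)); last by congr xp; ring.
rewrite [LHS]addrA subrK; by congr (_ - _); apply: eq_scale => //; congr xp; ring.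
Qed.

Lemma u_hpow i j : u i * hpow j = xp (2 * (i * j)) *: (hpow j * u i).
Proof.
rewrite /hpow (u_gmon m0 xi_prim L); apply: eq_scale; first by congr xp; ring.
by congr (gmon _ _ _ _ _ _ * _); ring.
Qed.

Lemma hpowD a b : hpow a * hpow b = hpow (a + b).
Proof. by rewrite /hpow (gmonM L); congr (gmon _ _ _ _ _ _); ring. Qed.

Lemma cop_u_term_mul i j a b : cop_u_term i a * cop_u_term j b =
  xp (2 * (a * (i - a)) + 2 * (b * (j - b)) + 2 * ((i - a) * b)) *:
  t (u a * u b) (hpow (a + b) * (u (i - a) * u (j - b))).
Proof.
rewrite /cop_u_term uscaleAl uscaleAr scalerA tM.
rewrite -(mulrA (hpow a)) (mulrA (u (i - a))) u_hpow uscaleAl -(mulrA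
  (hpow b)) uscaleAr tZr.
by rewrite (mulrA (hpow a)) hpowD scalerA -!xpD.
Qed.

(* The first sum is shifted by [- b], so that [r] is the sum of the two
   summation indices. *)
Lemma cop_u_mul_shift i j : cop_u i * cop_u j = \sum_(r < m) \sum_(b < m) cop_u_term i
  (r%:Z - b%:Z) * cop_u_term j b%:Z.
Proof.
rewrite [X in _ * X]/cop_u mulr_sumr exchange_big; apply: eq_bigr => b _ /=.
rewrite -mulr_suml; congr (_ * _); apply/esym.
exact: (sum_shift m0 (cop_u_term_period i) (- b%:Z)).
Qed.

Hypothesis mR : m%:R != 0 :> k.

(* The common shape of the terms of both sides of the [u_i u_j] relation. *)
Let scal_uu (i j : int) p : int := j * j + m%:Z * j + 2 * (i + j) - 2 * i * p%:Z.
Let term_uu (i j : int) r p : TT := t (T (d%:Z * p%:Z - e%:Z) 1 * y ^+ r)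
  (T (d%:Z * p%:Z - e%:Z) (r%:Z + 1) * y ^+ (resm m (i + j - r%:Z))).

(** Written so that [b] occurs only in the last factor
    [gamma ^ (b (r + p - q))]. *)
Lemma cop_u_term_mulE i j r b : (r < m)%N -> cop_u_term i (r%:Z - b) * cop_u_term j b =
  \sum_(p < m) \sum_(q < m)
   (B r p * B (resm m (i + j - r%:Z)) q * m%:R^-1 *
     xp (scal_uu i j p + 2 * ((i - r%:Z) * (r%:Z + p%:Z - q%:Z))) *
     (m%:R^-1 * xp (2 * (r%:Z + p%:Z - q%:Z) * b))) *:
   t (T (d%:Z * p%:Z - e%:Z) 1 * y ^+ r)
     (T (d%:Z * (q%:Z - r%:Z) - e%:Z) (r%:Z + 1) * y ^+ (resm m (i + j - r%:Z))).
Proof.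
move=> rm'; rewrite cop_u_term_mul subrK !(uuE m0 xi_prim L) subrK.
have -> : i - (r%:Z - b) + (j - b) = i + j - r%:Z by ring.
rewrite resm_small // mulr_sumr t_suml scaler_sumr; apply: eq_bigr => p _.
rewrite t_sumr scaler_sumr; apply: eq_bigr => q _.
rewrite tZl uscaleAr tZr !scalerA; apply: eq_scale.
  transitivity (B r p * B (resm m (i + j - r%:Z)) q * m%:R^-1 * m%:R^-1 * 
   (xp (2 * ((r%:Z - b) * (i - (r%:Z - b))) + 2 * (b * (j - b)) + 2 * ((i -
     (r%:Z - b)) * b)) *
    xp (b * b + m%:Z * b + 2 * r%:Z - 2 * (r%:Z - b) * p%:Z) *
    xp ((j - b) * (j - b) + m%:Z * (j - b) + 2 * (i + j - r%:Z) -
          2 * (i - (r%:Z - b)) * q%:Z))); first by ring.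
  rewrite -!xpD.
  transitivity (B r p * B (resm m (i + j - r%:Z)) q * m%:R^-1 * m%:R^-1 * 
   (xp (scal_uu i j p + 2 * ((i - r%:Z) * (r%:Z + p%:Z - q%:Z))) *
     xp (2 * (r%:Z + p%:Z - q%:Z) * b))); last by ring.
  by rewrite -!xpD; congr (_ * xp _); rewrite /scal_uu; ring.
congr (t _ _); rewrite mulrA (gmonM L).
by congr (gmon _ _ _ _ _ _ * _); ring.
Qed.

(** Summing over [b] leaves the terms with [q] congruent to [r + p]; as [q < m],
    there is one such term if [r + p < m], and otherwise the binomial of
    [r + p] over [r] is zero. *)
Lemma cop_u_mul i j : cop_u i * cop_u j = \sum_(r < m) \sum_(p < m)
   (B r p * (if (r + p < m)%N then B (resm m (i + j - r%:Z)) (r + p) else 0) * m%:R^-1 *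
     xp (scal_uu i j p)) *: term_uu i j r p.
Proof.
rewrite cop_u_mul_shift; apply: eq_bigr => r _.
under eq_bigr => b _ do rewrite cop_u_term_mulE //.
rewrite exchange_big; apply: eq_bigr => p _; rewrite exchange_big /=.
under eq_bigr => q _ do rewrite -scaler_suml -mulr_sumr -mulr_sumr gamma_sum //.
case: ltnP => rp; last first.
  rewrite mulr0 !mul0r scale0r big1 // => q _.
  by rewrite (qbin_eq0 m0 xi_prim) // !mul0r scale0r.
rewrite (bigD1 (Ordinal rp)) //= big1 ?addr0 => [|q qE].
  have -> : r%:Z + p%:Z - (r + p)%N%:Z = 0 by rewrite PoszD subrr.
  rewrite dvdz0 mulVf // mulr1 mulr0 mulr0 addr0 /term_uu.
  congr (_ *: t _ (gmon _ _ _ _ _ _ * _)); rewrite PoszD; ring.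
case: ifP => [/dvdzP[c cE]|]; last by rewrite !mulr0 scale0r.
case/eqP: qE; apply: val_inj => /=.
have qm := ltn_ord q; have c0 : c = 0.
  have [h1 h2] : (c * m%:Z < 1 * m%:Z)%R /\ ((- 1) * m%:Z < c * m%:Z)%R by rewrite -cE; lia.
  have m0' : (0 < m%:Z)%R by lia.
  by move: h1 h2; rewrite !(Num.Theory.ltr_pM2r m0'); lia.
by rewrite c0 mul0r in cE; lia.
Qed.

Let t1y_tyg : t 1 y * t y g = xp 2 *: (t y g * t 1 y).
Proof. by rewrite !tM (Lyg L) tZr mul1r mulr1. Qed.

Lemma cop_y_exp n : cop_y ^+ n =
  \sum_(r < n.+1) B r (n - r) *: t (y ^+ r) (g ^+ r * y ^+ (n - r)).
Proof.
rewrite /cop_y (qbinomial t1y_tyg); apply: eq_bigr => r _.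
by rewrite !tX expr1n tM mulr1.
Qed.

(** In the [q]-binomial theorem for the exponent [m] all inner terms vanish, since
    [gamma] has order [m]. *)
Lemma cop_y_exp_m : cop_y ^+ m = t (y ^+ m) (g ^+ m) + t 1 (y ^+ m).
Proof.
rewrite cop_y_exp; case: m m0 (@qbin_eq0 _ _ _ m0 xi_prim) => // m' _ B0.
rewrite big_ord_recr big_ord_recl /= subnn subn0 qbin0n qbinn0 !scale1r !mul1r mulr1.
rewrite big1 => [|r _]; first by rewrite addr0 addrC.
have rm' := ltn_ord r; rewrite B0 ?scale0r //; rewrite /bump; lia.
Qed.

Lemma zp_X p : zp x x' (- e%:Z) * X ^+ p = T (d%:Z * p%:Z - e%:Z) 0.
Proof.
rewrite XT (gmonX L) (gmon_zpx x x' g g') (gmonM L).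
by congr (gmon _ _ _ _ _ _); rewrite ?mul0r ?addr0 // addrC.
Qed.

Lemma x_hpow j : x * hpow j = hpow j * x.
Proof.
transitivity (T 1 0 * hpow j); first by rewrite -(gmon_x x x' g g').
transitivity (hpow j * T 1 0); last by rewrite -(gmon_x x x' g g').
by rewrite /hpow !(gmonM L); congr (gmon _ _ _ _ _ _); ring.
Qed.

(** The other side of the relation, expanded over the same monomials by the
    [q]-binomial theorem for [Delta(y) ^ n]. *)
Lemma cop_uu i j (n := resm m (i + j)) :
  (m%:R^-1 * xp (j * j + m%:Z * j)) *:
     (zp (t x x) (t x' x') (- e%:Z) * Phis m xi (t x x ^+ d) i n * cop_y ^+ n * t g g) =
  \sum_(r < m) \sum_(p < m)
   ((if (r <= n)%N then B r (n - r) * B n p else 0) * m%:R^-1 *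
     xp (scal_uu i j p)) *: term_uu i j r p.
Proof.
have nm : (n < m)%N by apply: resm_lt.
rewrite t_zp cop_y_exp (big_ord_widen m (fun r => B r (n - r) *: t (y ^+ r)
  (g ^+ r * y ^+ (n - r)))) //.
rewrite big_mkcond mulr_sumr mulr_suml scaler_sumr; apply: eq_bigr => r _.
rewrite ltnS; case: leqP => rn; last first.
  rewrite mulr0 mul0r scaler0 big1 // => p _.
  by rewrite !mul0r scale0r.
rewrite /Phis mulr_sumr !mulr_suml scaler_sumr; apply: eq_bigr => p _.
rewrite !(uscaleAl, uscaleAr) !scalerA !tX -/X !tM zp_X.
rewrite -(mulrA (T _ _) (y ^+ r)) (yg m0 xi_prim L) uscaleAr tZl scalerA.
rewrite (mulrA (T _ _) (g ^+ r)) -(mulrA _ (y ^+ (n - r)))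
  (yg m0 xi_prim L) uscaleAr tZr scalerA.
apply: eq_scale.
  transitivity (B r (n - r) * B n p * m%:R^-1 * 
    (xp (j * j + m%:Z * j) * xp (- (2 * i * p%:Z)) * xp (2 * r%:Z) * xp (2 *
      (n - r)%N%:Z))).
    by ring.
  rewrite -!xpD; congr (_ * _); rewrite -subzn // /scal_uu /n.
  have [c ->] := resmE m0 (i + j).
  by apply: (xp_mod m0 xi_prim (c := c)); ring.
rewrite /term_uu; have -> : resm m (i + j - r%:Z) = (n - r)%N.
  rewrite -(resm_small (m := m) (i := (n - r)%N)); last by lia.
  rewrite -subzn // /n; have [c ->] := resmE m0 (i + j).
  by rewrite [i + j + _ - _]addrAC resmD.
congr (t _ _); rewrite mulrA; first by rewrite (gmonM L) addr0 add0r.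
congr (_ * _); rewrite (gmon_gX x x' g g') !(gmonM L).
by congr (gmon _ _ _ _ _ _); ring.
Qed.

(** The proposed values of the coproduct satisfy the relations; by the universal
    property they define an algebra map. *)
Theorem coproduct_laws : Dlaws m d xi (t x x) (t x' x') (t g g) (t g' g') cop_y cop_u.
Proof.
split.
- by rewrite tM (Lxx' L) t1.
- by rewrite tM (Lx'x L) t1.
- by rewrite tM (Lgg' L) t1.
- by rewrite tM (Lg'g L) t1.
- by rewrite !tM (Lxg L).
- by rewrite /cop_y mulrDr mulrDl !tM (Lxg L) (Lxy L) mulr1 mul1r.
- rewrite /cop_y mulrDr mulrDl !tM (Lyg L) tZl tZr mulr1 mul1r scalerDr; congr (_ + _).
- rewrite cop_y_exp_m tX (Lym L) (Lgm L) tBl tBr t1 addrC addrA subrK.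
  by [].
- by rewrite !tX (Lgm L).
- exact: cop_u_period.
- move=> i; rewrite /cop_u mulr_sumr mulr_suml; apply: eq_bigr => j _.
  rewrite /cop_u_term uscaleAr uscaleAl !tM (Lxu L); congr (_ *: t _ _).
  by rewrite -mulrA -(Lxu L) !mulrA x_hpow.
- by move=> i; apply: cop_y_mul_u.
- by move=> i; rewrite cop_y_mul_u -cop_u_mul_y.
- move=> i; rewrite t_zp /cop_u mulr_sumr mulr_suml scaler_sumr; apply: eq_bigr => j _.
  rewrite /cop_u_term uscaleAl uscaleAr !tM !scalerA.
  rewrite (Lug L) -(mulrA (hpow _)) (Lug L) tZl uscaleAr tZr !scalerA -!xpD.
  apply: eq_scale; first by congr xp; ring.
  congr (t _ _).
  rewrite !(gmon_zpxg x x' g g') !mulrA; congr (_ * _); rewrite !(gmonM L).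
  by congr (gmon _ _ _ _ _ _); ring.
move=> i j; rewrite cop_uu cop_u_mul; apply: eq_bigr => r _; apply: eq_bigr => p _.
apply: eq_scale => //; congr (_ * _ * _).
rewrite -(qbin_coproduct (resm_lt m0 (i + j)) (ltn_ord r) (ltn_ord p)).
congr (_ * (if _ then B _ _ else _)).
by have [c ->] := resmE m0 (i + j); rewrite [i + j + _ - _]addrAC resmD.
Qed.

End Coproduct.

(** * The counit *)

Section Counit.
Variables (k : fieldType) (m d : nat) (xi : k).
Hypotheses (m0 : (0 < m)%N) (xi_prim : (2 * m).-primitive_root xi).
Hypothesis mR : m%:R != 0 :> k.
Local Notation xp := (xp xi).

Variable A : ualgType k.

(** The counit on [u_z]. *)
Definition delta (z : int) : uring A := (m%:Z %| z)%Z%:R.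

Lemma one_zp z : zp (1 : uring A) 1 z = 1.
Proof. by case: z => n; rewrite /zp expr1n. Qed.

Lemma delta_period z c : delta (z + m%:Z * c) = delta z.
Proof. by rewrite /delta rpredDr // dvdz_mulr. Qed.

(** With [x = g = 1] and [y = 0], the factor [phi_i] is zero exactly when [m]
    divides [i + 1], and for [m] dividing [i + j] the relation for [u_i u_j]
    involves the value at 1 of a product of [m - 1] factors, which is a character
    sum equal to [m] or 0. *)
Lemma counit_laws : Dlaws m d xi (1 : uring A) 1 1 1 0 delta.
Proof.
split; rewrite ?mulr1 ?mulr0 ?mul0r ?expr1n ?scaler0 //.
- by rewrite expr0n (gtn_eqF m0) subrr.
- by move=> i; rewrite -[m%:Z]mulr1 delta_period.
- by move=> i; rewrite mulr1 mul1r.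
- move=> i; rewrite mul0r /phi1 /delta.
  case: dvdzP => [[c cE]|_]; last by rewrite mulr0.
  rewrite (_ : xp (- (2 * (i + 1))) = 1) ?scale1r ?subrr ?mul0r //.
  apply/eqP; rewrite cE (xp_eq1 xi_prim) -mulrN dvdz_mul2l //.
  by apply/dvdzP; exists (- c); ring.
- by move=> i; rewrite mul0r mulr0 scaler0.
- move=> i; rewrite mulr1 one_zp !mul1r /delta.
  case: dvdzP => [[c cE]|_]; last by rewrite scaler0.
  rewrite (_ : xp (2 * i) = 1) ?scale1r //.
  by apply/eqP; rewrite cE (xp_eq1 xi_prim) dvdz_mul2l // dvdz_mull.
move=> i j; rewrite one_zp mul1r mulr1.
have PhisE : Phis m xi (1 : uring A) i 0 = m%:R *: delta i.
  transitivity ((\sum_(p < m) xp (2 * (- i) * p%:Z)) *: (1 : uring A)).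
    rewrite /Phis scaler_suml; apply: eq_bigr => p _.
    by rewrite qbin0n mul1r expr1n; apply: eq_scale => //; congr xp; ring.
  rewrite (gamma_sum xi_prim) rpredN /delta.
  by case: ifP; rewrite ?scale0r ?scaler0.
have [n0|] := eqVneq (resm m (i + j)) 0%N; last first.
  rewrite expr0n => n0; rewrite (negPf n0) mulr0 scaler0 /delta.
  move: n0; rewrite resm_eq0; case: (boolP (_ %| i)%Z) => di; last by rewrite mul0r.
  by rewrite rpredDl // => /negPf->; rewrite mulr0.
rewrite n0 mulr1 PhisE /delta.
case: (boolP (_ %| i)%Z) => di; last by rewrite mul0r !scaler0.
move/eqP: n0; rewrite resm_eq0 rpredDl // => dj; rewrite dj !mulr1 scalerA.
case/dvdzP: dj => c ->; rewrite mulrAC mulVf // mul1r.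
have := xp_sq_period m0 xi_prim 0 c; rewrite !mulr0 !add0r => E.
by rewrite (mulrC c) E scale1r.
Qed.
End Counit.

(** * The antipode *)

Section PhiInverse.
Variables (k : fieldType) (m : nat) (xi : k).
Hypotheses (m0 : (0 < m)%N) (xi_prim : (2 * m).-primitive_root xi).
Local Notation xp := (xp xi).
Let xpD := xpD m0 xi_prim.
Variables (A : ualgType k) (X X' : uring A).

Lemma phi1_comm c a : X * c = c * X -> phi1 xi X a * c = c * phi1 xi X a.
Proof. by move=> Xc; rewrite /phi1 mulrBl mulrBr mul1r mulr1 uscaleAl uscaleAr Xc. Qed.

Lemma Phi_comm c a n : X * c = c * X -> Phi xi X a n * c = c * Phi xi X a n.
Proof.
move=> Xc; elim: n => [|n IH]; first by rewrite /Phi big_ord0 mul1r mulr1.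
by rewrite PhiSr -mulrA phi1_comm // !mulrA IH.
Qed.

Lemma Phi_period a c n : Phi xi X (a + m%:Z * c) n = Phi xi X a n.
Proof.
by apply: eq_bigr => l _; rewrite addrAC (per_mul (phi1m m0 xi_prim X)).
Qed.

Hypotheses (XX' : X * X' = 1) (X'X : X' * X = 1).

Lemma phi1_inv a : phi1 xi X' a =
  - (xp (- (2 * (a + 1))) *: (X' * phi1 xi X (- a - 2))).
Proof.
rewrite /phi1 mulrBr mulr1 uscaleAr X'X scalerBr scalerA -xpD opprB.
congr (_ - _); rewrite -[LHS]scale1r -(xp0 xi); apply: eq_scale => //.
by congr xp; ring.
Qed.

(** Each factor for [X^-1] is [- X^-1] times a scalar and a factor for [X], as in
    [1 - c X^-1 = - c X^-1 (1 - c^-1 X)]; the indices are reflected, so the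
    product runs backwards over consecutive indices. *)
Lemma Phi_inv a n : Phi xi X' a n =
  (xp (m%:Z * n%:Z - 2 * (a + 1) * n%:Z - n%:Z * (n%:Z - 1))) *:
  (X' ^+ n * Phi xi X (- a - n%:Z - 1) n).
Proof.
elim: n a => [|n IH] a.
  by rewrite /Phi !big_ord0 mulr1 !mulr0 mul0r !subr0 scale1r.
rewrite PhiSl IH phi1_inv PhiSr uscaleAr mulNr uscaleAl scalerN scalerA.
have -> : - a - n.+1%:Z - 1 + n%:Z = - a - 2 by lia.
have -> : - (a + 1) - n%:Z - 1 = - a - n.+1%:Z - 1 by lia.
have X'P : phi1 xi X (- a - 2) * X' ^+ n = X' ^+ n * phi1 xi X (- a - 2).
  apply: phi1_comm; apply: GRing.commrX; rewrite /GRing.comm XX' X'X //.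
rewrite -(mulrA X') (mulrA (phi1 _ _ _)) X'P -(mulrA (X' ^+ n)).
rewrite (Phi_comm _ _ (esym _)); last first.
  by rewrite -phi1_comm.
rewrite (mulrA X') -exprS -scaleN1r -[-1](xpm m0 xi_prim) scalerA -!xpD.
apply: eq_scale => //; congr xp; rewrite (_ : n.+1%:Z = n%:Z + 1) ?intS 1?addrC //; ring.
Qed.
End PhiInverse.

Section Halves.
Variables (m d : nat).
Hypotheses (m0 : (0 < m)%N) (parity : ~~ odd ((1 + m) * d)).
Local Notation e := (((1 + m) * d)./2).
Local Notation f := (((m - 1) * d)./2).

(* The parity hypothesis makes both halves exact. *)
Lemma double_e : e%:Z * 2 = (m%:Z + 1) * d%:Z.
Proof.
have := even_halfK parity; move: (_./2) => h hE.
have : h%:Z * 2 = ((1 + m) * d)%N%:Z by lia.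
by move->; rewrite PoszM PoszD addrC.
Qed.
Lemma double_f : f%:Z * 2 = (m%:Z - 1) * d%:Z.
Proof.
have mE : ((1 + m) * d = (m - 1) * d + d.*2)%N 
  by rewrite -mul2n -mulnDl; congr (_ * _)%N; lia.
have : ~~ odd ((m - 1) * d) by move: parity; rewrite mE oddD odd_double addbF.
move/even_halfK; move: (_./2) => h hE.
have : h%:Z * 2 = ((m - 1) * d)%N%:Z by lia.
by move->; rewrite PoszM subzn.
Qed.

Lemma double_ef : f%:Z + e%:Z = d%:Z * m%:Z.
Proof.
have : (f%:Z + e%:Z) * 2 = d%:Z * m%:Z * 2 by rewrite mulrDl double_e double_f; ring.
by move: (d%:Z * m%:Z) => z; lia.
Qed.

End Halves.

Section Antipode.
Variables (k : fieldType) (m d : nat) (xi : k).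
Hypotheses (m0 : (0 < m)%N) (xi_prim : (2 * m).-primitive_root xi).
Hypothesis parity : ~~ odd ((1 + m) * d).
Local Notation xp := (xp xi).
Local Notation B := (qbin (xp 2)).
Local Notation e := (((1 + m) * d)./2).
Local Notation f := (((m - 1) * d)./2).
Let xpD := xpD m0 xi_prim.

Variables (A : ualgType k) (x x' g g' y : uring A) (u : int -> uring A).
Hypothesis L : Dlaws m d xi x x' g g' y u.
Local Notation T := (gmon x x' g g').
Local Notation O := (uring (uop A)).

(** The antipode on [u_z], for every integer [z]: up to the scalar it is
    [x^(-f) h^(-z-1) u_z] with [h = x^(-d) g].  For [0 <= z < m] the relation
    [g ^ m = x ^ (m d)] turns the exponent [- z - 1] of [g] into [m - z - 1], as
    in [anti_u_explicit]; the present form is visibly periodic in [z]. *)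
Definition anti_exp (z : int) : int := m%:Z * z - z * z - 2 * z.
Definition anti_u (z : int) : uring A :=
  xp (anti_exp z) *: (T ((z + 1) * d%:Z - f%:Z) (- z - 1) * u z).
Definition anti_y : uring A := - (y * g').

Lemma anti_yE : anti_y = xp (m%:Z - 2) *: (T 0 (- 1) * y).
Proof.
rewrite /anti_y -scaleN1r -(xpm m0 xi_prim) xpD -scalerA; congr (_ *: _).
have := y_gmon m0 xi_prim L 1 0 (- 1); rewrite -(gmon_g' x x' g g').
by move=> ->; apply: eq_scale => //; congr xp; ring.
Qed.

Lemma anti_u_period z : anti_u (z + m%:Z) = anti_u z.
Proof.
rewrite /anti_u (Lum L); apply: eq_scale.
  by apply: (xp_mod m0 xi_prim (c := - z - 1)); rewrite /anti_exp; ring.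
congr (_ * _); have -> : - (z + m%:Z) - 1 = - z - 1 + m%:Z * (- 1) by ring.
rewrite (gmon_period L); congr (gmon _ _ _ _ _ _); rewrite PoszM; ring.
Qed.

Lemma anti_u_gmon i a b : anti_u i * T a b = xp (anti_exp i + 2 * i * b) *:
  (T ((i + 1) * d%:Z - f%:Z - a - 2 * d%:Z * b) (- i - 1 + b) * u i).
Proof.
rewrite /anti_u uscaleAl -(mulrA (T _ _))
  (u_gmon m0 xi_prim L) uscaleAr scalerA -xpD mulrA (gmonM L).
by apply: eq_scale => //; congr (gmon _ _ _ _ _ _ * _); ring.
Qed.

Lemma gmon_anti_u i a b : T a b * anti_u i = xp (anti_exp i) *:
  (T (a + (i + 1) * d%:Z - f%:Z) (b - i - 1) * u i).
Proof.
rewrite /anti_u uscaleAr mulrA (gmonM L).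
by apply: eq_scale => //; congr (gmon _ _ _ _ _ _ * _); ring.
Qed.

Lemma anti_u_mul_y i : anti_u i * anti_y = xp (anti_exp i + m%:Z - 3 - 2 * i) *:
  (T ((i + 2) * d%:Z - f%:Z) (- i - 2) * (y * u i)).
Proof.
rewrite anti_yE uscaleAr (mulrA (anti_u i)) anti_u_gmon uscaleAl -(mulrA (T _ _) (u i)).
rewrite (uyE m0 xi_prim L) !uscaleAr (mulrA (T _ _)) (gmonM L) !scalerA -!xpD;
  apply: eq_scale; first by congr xp; ring.
by congr (gmon _ _ _ _ _ _ * _); ring.
Qed.

Lemma uop_zp s s' z : zp (s : O) s' z = zp (s : uring A) s' z.
Proof. by case: z => n; apply: uop_exp. Qed.
Lemma uop_Phis (X : uring A) i n : Phis m xi (X : O) i n = Phis m xi X i n.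
Proof. by apply: eq_bigr => p _; rewrite uop_exp. Qed.

Lemma zp_swap z : zp x' x z = T (- z) 0.
Proof.
by rewrite (zp_opp _ (Lxx' L) (Lx'x L)) (gmon_zpx x x' g g').
Qed.
Lemma x'_exp n : x' ^+ n = T (- n%:Z) 0.
Proof. exact: (zp_swap n%:Z). Qed.
Lemma g'_exp n : g' ^+ n = T 0 (- n%:Z).
Proof.
elim: n => [|n IH]; first by rewrite oppr0 (gmon0 x x' g g').
rewrite exprSr IH.
transitivity (T 0 (- n%:Z) * T 0 (- 1)); first by rewrite -(gmon_g' x x' g g').
by rewrite (gmonM L); congr (gmon _ _ _ _ _ _); lia.
Qed.

Lemma g'_y : g' * y = xp 2 *: (y * g').
Proof.
have := y_gmon m0 xi_prim L 1 0 (- 1); rewrite -(gmon_g' x x' g g') expr1 => ->.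
by rewrite scalerA -xpD -[LHS]scale1r; apply: eq_scale.
Qed.

Lemma anti_y_exp n : anti_y ^+ n = xp (m%:Z * n%:Z + n%:Z * (n%:Z - 1)) *:
  (y ^+ n * g' ^+ n).
Proof.
elim: n => [|n IH]; first by rewrite !mulr0 mul0r scale1r mulr1.
rewrite exprSr IH /anti_y mulrN uscaleAl.
have -> : y ^+ n * g' ^+ n * (y * g') = xp (2 * n%:Z) *: (y ^+ n.+1 * g' ^+ n.+1).
  rewrite -mulrA (mulrA (g' ^+ n)) g'_exp.
  have := y_gmon m0 xi_prim L 1 0 (- n%:Z); rewrite expr1 => E.
  have -> : T 0 (- n%:Z) * y = xp (2 * n%:Z) *: (y * T 0 (- n%:Z)).
    rewrite E scalerA -xpD -[LHS]scale1r; apply: eq_scale => //.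
    by rewrite -(xp0 xi); congr xp; ring.
  rewrite uscaleAl uscaleAr -g'_exp; congr (_ *: _).
  by rewrite !exprSr -!mulrA.
rewrite scalerA -xpD -scaleN1r -[-1](xpm m0 xi_prim) scalerA -xpD.
apply: eq_scale => //; congr xp; rewrite (_ : n.+1%:Z = n%:Z + 1); last by lia.
by ring.
Qed.

Lemma anti_y_exp_m : anti_y ^+ m = 1 - x' ^+ (m * d).
Proof.
rewrite anti_y_exp (Lym L) g'_exp.
have -> : T 0 (- m%:Z) = x' ^+ (m * d).
  rewrite x'_exp -[- m%:Z]add0r -mulrN1 (gmon_period L) add0r mulrN1.
  by [].
rewrite mulrBl mul1r (_ : x ^+ _ * _ = 1); last first.
  by rewrite (gmon_xX x x' g g') x'_exp (gmonM L) subrr addr0 (gmon0 x x' g g').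
rewrite (xp_mod m0 xi_prim (b := m%:Z) (c := m%:Z - 1)); last by ring.
by rewrite (xpm m0 xi_prim) scaleN1r opprB.
Qed.

(* The next three lemmas are relations of the opposite algebra, whence the
   reversed order of the factors. *)
Lemma anti_u_phi i : anti_u i * anti_y = anti_u (i + 1) * phi1 xi (x' ^+ d) i.
Proof.
rewrite anti_u_mul_y (yuE L) /phi1 (mulrBr (anti_u _)) mulr1 (mulrBr
  (T _ _)) scalerBr !uscaleAr x'_exp anti_u_gmon /anti_u !scalerA -!xpD.
congr (_ - _); last rewrite (mulrA (T _ _)) (gmonM L).
  by apply: eq_scale; [congr xp; rewrite /anti_exp|congr (gmon _ _ _ _ _ _ * _)]; ring.
by apply: eq_scale; [congr xp; rewrite /anti_exp|congr (gmon _ _ _ _ _ _ * _)]; ring.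
Qed.

Lemma anti_u_y i : anti_u i * anti_y = xi *: (anti_y * (anti_u i * x' ^+ d)).
Proof.
rewrite anti_u_mul_y x'_exp anti_u_gmon anti_yE uscaleAl uscaleAr scalerA -[xi]/(xp 1)
  scalerA -!xpD.
rewrite -(mulrA (T _ _) y) (mulrA y).
have := y_gmon m0 xi_prim L 1; rewrite expr1 => ->.
rewrite uscaleAl uscaleAr scalerA -xpD -(mulrA _ y) (mulrA (T _ _) (T _ _)) (gmonM L).
by apply: eq_scale; [congr xp|congr (gmon _ _ _ _ _ _ * _)]; ring.
Qed.

Lemma anti_u_g i : g' * anti_u i = xp (2 * i) *: (anti_u i * (g' * zp x' x (-
  (2 * d)%N%:Z))).
Proof.
transitivity (T 0 (- 1) * anti_u i); first by rewrite -(gmon_g' x x' g g').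
transitivity (xp (2 * i) *: (anti_u i * (T 0 (- 1) * T (2 * d%:Z) 0))); last first.
  by rewrite -(gmon_g' x x' g g') zp_swap opprK.
rewrite (gmonM L) gmon_anti_u anti_u_gmon scalerA -xpD.
by apply: eq_scale; [congr xp|congr (gmon _ _ _ _ _ _ * _)]; ring.
Qed.

Lemma anti_u_mul i j : anti_u j * anti_u i = xp (anti_exp i + anti_exp j - 2 * j *
  (i + 1)) *:
  (T ((i + j + 2) * d%:Z) (- (i + j + 2)) * (u j * u i)).
Proof.
rewrite {2}/anti_u uscaleAr (mulrA (anti_u j)) anti_u_gmon uscaleAl scalerA -xpD -(mulrA
  (T _ _)).
by apply: eq_scale; [congr xp|congr (gmon _ _ _ _ _ _ * _)]; ring.
Qed.

(** Both sides are brought to a monomial times [P], the product of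
    [N = m - 1 - n] consecutive factors starting at [j], times [y ^ n].  On the
    right, [Phi_inv] turns the factors in [x^(-d)] starting at [i] into factors
    in [x^d] starting at [- i - N - 1], which is congruent to [j] modulo [m]. *)
Lemma anti_uu i j (n := resm m (i + j)) : anti_u j * anti_u i = (m%:R^-1 * xp
  (j * j + m%:Z * j)) *:
  (g' * (anti_y ^+ n * (Phis m xi (x' ^+ d) i n * zp x' x (- e%:Z)))).
Proof.
pose N := (m - n.+1)%N; pose P := Phi xi (x ^+ d) j N.
have nm : (n < m)%N by apply: resm_lt.
have NE : (m - N.+1 = n)%N by rewrite /N; lia.
have [c nE] := resmE m0 (i + j); rewrite -/n in nE.
have NZ : N%:Z = m%:Z - 1 - n%:Z by rewrite /N; lia.
have XX' : x ^+ d * x' ^+ d = 1.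
  by rewrite (gmon_xX x x' g g') x'_exp (gmonM L) subrr addr0 (gmon0 x x' g g').
have X'X : x' ^+ d * x ^+ d = 1.
  by rewrite (gmon_xX x x' g g') x'_exp (gmonM L) addNr addr0 (gmon0 x x' g g').
have PT a b : P * T a b = T a b * P.
  by apply: Phi_comm; rewrite (gmon_xX x x' g g') !(gmonM L) addrC [X in T _ X]addrC.
have Py r : P * y ^+ r = y ^+ r * P.
  apply: Phi_comm; apply/esym/GRing.commrX/esym/GRing.commrX.
  by rewrite /GRing.comm (Lxy L).
have lhs : anti_u j * anti_u i = (m%:R^-1 * xp (i * i + m%:Z * i +
  (anti_exp i + anti_exp j - 2 * j * (i + 1)) + 2 * n%:Z)) *:
    (T ((i + j + 2) * d%:Z - e%:Z) (- (i + j + 1)) * P * y ^+ n).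
  rewrite anti_u_mul (Luu L) (addrC j i) -/n -{1}NE -(Phi_sum m0 xi_prim) -/P;
    last by rewrite /N; lia.
  rewrite (gmon_zpx x x' g g') -(mulrA _ _ g) (yg m0 xi_prim L) !uscaleAr.
  rewrite (mulrA (_ * P)) -(mulrA _ P) PT !mulrA !(gmonM L) !scalerA.
  apply: eq_scale; first by rewrite !xpD; ring.
  by congr (gmon _ _ _ _ _ _ * _ * _); ring.
have rhs : g' * (anti_y ^+ n * (Phis m xi (x' ^+ d) i n * zp x' x (- e%:Z))) =
    xp (m%:Z * N%:Z - 2 * (i + 1) * N%:Z - N%:Z * (N%:Z - 1) +
        (m%:Z * n%:Z + n%:Z * (n%:Z - 1)) - 2 * n%:Z * n%:Z) *:
    (T (e%:Z - d%:Z * N%:Z) (- n%:Z - 1) * P * y ^+ n).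
  rewrite -{2}NE -(Phi_sum m0 xi_prim); last by rewrite /N; lia.
  rewrite (Phi_inv m0 xi_prim XX' X'X).
  have -> : Phi xi (x ^+ d) (- i - N%:Z - 1) N = P.
    rewrite /P -(Phi_period m0 xi_prim (x ^+ d) j (c - 1)); congr Phi.
    by rewrite NZ nE; ring.
  rewrite anti_y_exp g'_exp x'_exp (gmonX L) zp_swap opprK !(uscaleAl, uscaleAr) !scalerA.
  rewrite -(mulrA (T _ _) P) PT (mulrA (T _ _) (T _ _)) (gmonM L).
  rewrite -(mulrA (y ^+ n)) (mulrA (T _ _) (T _ _)) (gmonM L) (mulrA (y ^+ n))
    (y_gmon m0 xi_prim L).
  rewrite !(uscaleAl, uscaleAr) scalerA -(mulrA (T _ _) (y ^+ n)) -Py.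
  transitivity (xp (m%:Z * N%:Z - 2 * (i + 1) * N%:Z - N%:Z * (N%:Z - 1)) *
    xp (m%:Z * n%:Z + n%:Z * (n%:Z - 1)) * xp (- (2 * n%:Z * n%:Z)) *:
      (T 0 (- 1) * (T (e%:Z - d%:Z * N%:Z) (- n%:Z) * (P * y ^+ n)))).
    rewrite -(gmon_g' x x' g g') -!xpD.
    by apply: eq_scale; [congr xp|congr (_ * (gmon _ _ _ _ _ _ * _))]; ring.
  rewrite !mulrA (gmonM L) -!xpD.
  by apply: eq_scale; [congr xp|congr (gmon _ _ _ _ _ _ * _ * _)]; ring.
rewrite lhs rhs scalerA -(mulrA m%:R^-1) -xpD; apply: eq_scale.
  congr (_ * _).
  apply: (xp_mod m0 xi_prim (c := 2 * i - n%:Z + 2 * c + 2 *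
    (i + j) * c + m%:Z * c * c - i * c)).
  by rewrite NZ nE /anti_exp; ring.
congr (_ * _ * _).
have -> : - n%:Z - 1 = - (i + j + 1) + m%:Z * (- c) by rewrite nE; ring.
rewrite (gmon_period L) NZ PoszM; congr (gmon _ _ _ _ _ _).
apply/eqP; rewrite subr_eq -subr_eq0; apply/eqP.
transitivity ((m%:Z + 1) * d%:Z - e%:Z * 2); last by rewrite (double_e m0 parity) subrr.
by rewrite nE; ring.
Qed.

Lemma g'_x' : g' * x' = x' * g'.
Proof.
transitivity (T 0 (- 1) * T (- 1) 0);
  first by rewrite -(gmon_x' x x' g g') -(gmon_g' x x' g g').
transitivity (T (- 1) 0 * T 0 (- 1));
  last by rewrite -(gmon_x' x x' g g') -(gmon_g' x x' g g').
by rewrite !(gmonM L) addrC [X in T _ X]addrC.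
Qed.

Lemma antipode_laws : @Dlaws k m d xi _ (x' : O) x g' g anti_y anti_u.
Proof.
split.
- exact: (Lxx' L).
- exact: (Lx'x L).
- exact: (Lgg' L).
- exact: (Lg'g L).
- exact: g'_x'.
- change (anti_y * x' = x' * anti_y).
  have := y_gmon m0 xi_prim L 1 (- 1) 0;
    rewrite expr1 mulr0 xp0 scale1r -(gmon_x' x x' g g') => yx.
  by rewrite /anti_y mulrN mulNr -mulrA g'_x' !mulrA yx.
- change (g' * anti_y = xp 2 *: (anti_y * g')).
  by rewrite /anti_y mulrN mulNr scalerN mulrA g'_y uscaleAl.
- by rewrite !uop_exp; apply: anti_y_exp_m.
- rewrite !uop_exp x'_exp g'_exp -[- m%:Z]add0r -mulrN1 (gmon_period L) add0r mulrN1.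
  by [].
- exact: anti_u_period.
- move=> i; change (anti_u i * x' = x * anti_u i).
  transitivity (anti_u i * T (- 1) 0); first by rewrite -(gmon_x' x x' g g').
  transitivity (T 1 0 * anti_u i); last by rewrite -(gmon_x x x' g g').
  rewrite gmon_anti_u anti_u_gmon; apply: eq_scale; first by congr xp; ring.
  by congr (gmon _ _ _ _ _ _ * _); ring.
- move=> i; rewrite uop_exp; exact: anti_u_phi.
- move=> i; rewrite uop_exp; exact: anti_u_y.
- move=> i; rewrite uop_zp; exact: anti_u_g.
by move=> i j; rewrite !uop_exp uop_zp uop_Phis; apply: anti_uu.
Qed.

Local Notation delta z := ((m%:Z %| z)%Z%:R : uring A).

Local Notation H j := (T (- (j * d%:Z)) j).

(** Both iterated coproducts of [u_i] are sums over two indices, matched by the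
    shift [j = n + l]; the scalars agree since
    [j (i - j) + l (j - l) = l (i - l) + n (i - l - n)]. *)
Lemma coassoc_sum (M : lmodType k) (t3 : uring A -> uring A -> uring A -> M) i :
  \sum_(j < m) \sum_(l < m)
    (xp (2 * (j%:Z * (i - j%:Z))) * xp (2 * (l%:Z * (j%:Z - l%:Z)))) *:
      t3 (u l%:Z) (H l%:Z * u (j%:Z - l%:Z)) (H j%:Z * u (i - j%:Z)) =
  \sum_(l < m) \sum_(n < m)
    (xp (2 * (l%:Z * (i - l%:Z))) * xp (2 * (n%:Z * (i - l%:Z - n%:Z)))) *:
      t3 (u l%:Z) (H l%:Z * u n%:Z) (H l%:Z * (H n%:Z * u (i - l%:Z - n%:Z))).
Proof.
rewrite exchange_big; apply: eq_bigr => l _; move: (l%:Z) => {}l.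
pose G (j : int) := (xp (2 * (j * (i - j))) * xp (2 * (l * (j - l)))) *:
      t3 (u l) (H l * u (j - l)) (H j * u (i - j)).
have HP j : H (j + m%:Z) = H j.
  rewrite -{2}[m%:Z]mulr1 (gmon_period L).
  by congr (gmon _ _ _ _ _ _); rewrite PoszM; ring.
have GP j : G (j + m%:Z) = G j.
  rewrite /G HP addrAC (Lum L).
  have -> : u (i - (j + m%:Z)) = u (i - j) by rewrite -(Lum L); congr u; ring.
  apply: eq_scale => //; rewrite -!xpD.
  by apply: (xp_mod m0 xi_prim (c := i - 2 * j - m%:Z + l)); ring.
transitivity (\sum_(j < m) G j%:Z) => //.
rewrite -(sum_shift m0 GP l); apply: eq_bigr => n _; move: (n%:Z) => {}n.
rewrite /G addrK (_ : i - (n + l) = i - l - n); last by ring.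
rewrite (mulrA (T _ _)) (gmonM L); apply: eq_scale;
  last congr (t3 _ _ (gmon _ _ _ _ _ _ * _)).
- by rewrite -!xpD; congr xp; ring.
- ring.
- ring.
Qed.

Hypothesis mR : m%:R != 0 :> k.

(** By [uuE] the index [j] occurs only in [gamma ^ (- (1 + p) j)], so the sum over
    [j] kills all [p] except [p = m - 1]; the binomial of [n + m - 1] over [n]
    is then zero unless [n = 0], that is, unless [m] divides [i]. *)
Lemma antipodel_sum i :
  \sum_(j < m) xp (2 * (j%:Z * (i - j%:Z))) *:
    (anti_u j%:Z * (T (- (j%:Z * d%:Z)) j%:Z * u (i - j%:Z))) = delta i.
Proof.
pose n := resm m i.
transitivity (\sum_(p < m) \sum_(j < m)
   ((xp (2 * (- (1 + p%:Z)) * j%:Z) * (m%:R^-1 * xp (i * i + m%:Z * i + 2 * i)) * B n p) *: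
   (T (d%:Z * (1 + p%:Z) - f%:Z - e%:Z) 0 * y ^+ n))).
  rewrite exchange_big; apply: eq_bigr => j _;
    rewrite (mulrA (anti_u _)) anti_u_gmon uscaleAl scalerA -(mulrA (T _ _))
    (uuE m0 xi_prim L).
  rewrite (_ : j%:Z + (i - j%:Z) = i); last by ring.
  rewrite mulr_sumr scaler_sumr; apply: eq_bigr => p _.
  rewrite uscaleAr scalerA (mulrA (T _ _)) (gmonM L) -/n; apply: eq_scale.
    transitivity (m%:R^-1 * B n p * (xp (2 * (j%:Z * (i - j%:Z))) * xp
      (anti_exp j%:Z + 2 * j%:Z * j%:Z) *
      xp ((i - j%:Z) * (i - j%:Z) + m%:Z * (i - j%:Z) + 2 * i - 2 * j%:Z * p%:Z)));
        first by ring.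
    transitivity (m%:R^-1 * B n p * (xp (2 * (- (1 + p%:Z)) * j%:Z) * xp
      (i * i + m%:Z * i + 2 * i))); last by ring.
    by rewrite -!xpD; congr (_ * xp _); rewrite /anti_exp; ring.
  by congr (gmon _ _ _ _ _ _ * _); ring.
have nm : (n < m)%N by apply: resm_lt.
have pm : (m.-1 < m)%N by rewrite ltn_predL.
rewrite (bigD1 (Ordinal pm)) //= [X in _ + X]big1 ?addr0; last first.
  move=> p pE; rewrite -scaler_suml -!mulr_suml (gamma_sum xi_prim) rpredN.
  case: ifP; last by rewrite !mul0r scale0r.
  rewrite -PoszD dvdzE !absz_nat => /dvdn_leq; rewrite add1n => /(_ isT) le.
  by case/eqP: pE; apply: val_inj => /=; have := ltn_ord p; lia.
rewrite -scaler_suml -!mulr_suml (gamma_sum xi_prim).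
have pmE : 1 + m.-1%:Z = m%:Z by lia.
rewrite pmE rpredN dvdzz mulrA mulfV // mul1r.
case: (boolP (_ %| i)%Z) => di; last first.
  by rewrite (qbin_eq0 m0 xi_prim) ?mulr0 ?scale0r //; move: di; rewrite -resm_eq0 -/n; lia.
have n0 : n = 0%N by apply/eqP; rewrite /n resm_eq0.
rewrite n0 qbin0n !mulr1; case/dvdzP: di => c ->.
have E := xp_sq_period m0 xi_prim 0 c; rewrite !mulr0 !add0r in E.
rewrite [c * _]mulrC xpD E mul1r.
rewrite (_ : xp _ = 1); last by apply/eqP; rewrite (xp_eq1 xi_prim) mulrA dvdz_mulr.
rewrite scale1r -(gmon0 x x' g g'); congr (gmon _ _ _ _ _ _).
have := (double_ef m0 parity); move: (d%:Z * m%:Z) => z; lia.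
Qed.

(** Here [j] occurs only in [gamma ^ (- (i + p) j)], so only those [p]
    survive for which [m] divides [n + p]; unless [n = p = 0] the binomial vanishes. *)
Lemma antipoder_sum i :
  \sum_(j < m) xp (2 * (j%:Z * (i - j%:Z))) *:
    (u j%:Z * (anti_u (i - j%:Z) * T (j%:Z * d%:Z) (- j%:Z))) = delta i.
Proof.
pose n := resm m i.
transitivity (\sum_(p < m) \sum_(j < m)
   ((xp (2 * (- (i + p%:Z)) * j%:Z) * m%:R^-1 * B n p) *:
   (T (i * d%:Z + d%:Z * p%:Z + (f%:Z + d%:Z - e%:Z)) (- i) * y ^+ n))).
  rewrite exchange_big; apply: eq_bigr => j _.
  rewrite anti_u_gmon uscaleAr (mulrA (u _))
    (u_gmon m0 xi_prim L) uscaleAl !scalerA -(mulrA (T _ _)) (uuE m0 xi_prim L).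
  rewrite (_ : j%:Z + (i - j%:Z) = i); last by ring.
  rewrite mulr_sumr scaler_sumr; apply: eq_bigr => p _.
  rewrite uscaleAr scalerA (mulrA (T _ _)) (gmonM L) -/n; apply: eq_scale.
    transitivity (m%:R^-1 * B n p * (xp (2 * (j%:Z * (i - j%:Z)))
        * xp (anti_exp (i - j%:Z) + 2 * (i - j%:Z) * - j%:Z)
        * xp (2 * j%:Z * (- (i - j%:Z) - 1 + - j%:Z))
        * xp ((i - j%:Z) * (i - j%:Z) + m%:Z * (i - j%:Z) + 2 * i - 2 * j%:Z * p%:Z)));
      first by ring.
    transitivity (m%:R^-1 * B n p * xp (2 * (- (i + p%:Z)) * j%:Z)); last by ring.
    rewrite -!xpD; congr (_ * _).
    by apply: (xp_mod m0 xi_prim (c := i - j%:Z)); rewrite /anti_exp; ring.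
  by congr (gmon _ _ _ _ _ _ * _); ring.
have fe : f%:Z + d%:Z - e%:Z = 0.
  have := (double_e m0 parity); have := (double_f m0 parity); rewrite mulrBl mulrDl mul1r.
  by move: (m%:Z * d%:Z) => z; lia.
have nm : (n < m)%N by apply: resm_lt.
rewrite fe (bigD1 (Ordinal m0)) //= [X in _ + X]big1 ?addr0; last first.
  move=> p pE; rewrite -scaler_suml -!mulr_suml (gamma_sum xi_prim) rpredN.
  case: (boolP (_ %| _)%Z); last by rewrite !mul0r scale0r.
  rewrite -resm_eq0 => ip.
  have [c nE] := resmE m0 i; rewrite -/n in nE.
  move: ip; rewrite -(resmD m _ c) addrAC -nE -PoszD resm_eq0 dvdzE !absz_nat =>
    /dvdn_leq np.
  have p0 : (0 < p)%N by rewrite lt0n; apply: contra pE => /eqP p0; apply/eqP/val_inj.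
  by rewrite (qbin_eq0 m0 xi_prim) ?mulr0 ?scale0r //; apply: np; rewrite addn_gt0 p0 orbT.
rewrite -scaler_suml -!mulr_suml (gamma_sum xi_prim) rpredN.
case: (boolP (_ %| i)%Z) => di; last by rewrite !mul0r scale0r.
have n0 : n = 0%N by apply/eqP; rewrite /n resm_eq0.
rewrite n0 qbin0n !mulr1 mulfV // scale1r mulr0 ?addr0.
case/dvdzP: di => c ->; rewrite -[- (c * _)]add0r.
have -> : 0 - c * m%:Z = 0 + m%:Z * (- c) by ring.
rewrite (gmon_period L) -(gmon0 x x' g g'); congr (gmon _ _ _ _ _ _).
by rewrite PoszM; ring.
Qed.

End Antipode.

(** * The Hopf axioms on generators *)

Section Hopf.
Variables (k : fieldType) (m d : nat) (xi : k).
Hypotheses (m0 : (0 < m)%N) (xi_prim : (2 * m).-primitive_root xi).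
Hypothesis parity : ~~ odd ((1 + m) * d).
Hypothesis mR : m%:R != 0 :> k.
Local Notation xp := (xp xi).

Variables (A : ualgType k) (x x' g g' y : uring A) (u : int -> uring A).
Hypothesis L : Dlaws m d xi x x' g g' y u.
Local Notation T := (gmon x x' g g').
Local Notation H j := (T (- (j * d%:Z)) j).
Local Notation V := (anti_u m d xi x x' g g' u).

Inductive is_gen : uring A -> Prop :=
| Genx : is_gen x | Genx' : is_gen x' | Geng : is_gen g | Geng' : is_gen g'
| Geny : is_gen y | Genu z : is_gen (u z).

Variables (E : ualgType k) (t : uring A -> uring A -> uring E).
Hypothesis t_bil : Defs.bilinear (t : A -> A -> E).
Hypothesis t1 : t 1 1 = 1.
Hypothesis tM : forall a b a' b', t a b * t a' b' = t (a * a') (b * b').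
Local Notation W := (cop_u m d xi x x' g g' u t).

Variables (Delta : A -> E) (eps : A -> k) (S : A -> A).
Hypotheses (hD : alg_hom Delta) (he : alg_hom (eps : A -> k^o))
  (hS : alg_hom (S : A -> uop A)).
Hypotheses (Dx : Delta x = t x x) (Dx' : Delta x' = t x' x')
  (Dg : Delta g = t g g) (Dg' : Delta g' = t g' g')
  (Dy : Delta y = t y g + t 1 y) (Du : forall z, Delta (u z) = W z).
Hypotheses (ex : eps x = 1) (ex' : eps x' = 1) (eg : eps g = 1) (eg' : eps g' = 1)
  (ey : eps y = 0) (eu : forall z, eps (u z) = (m%:Z %| z)%Z%:R).
Hypotheses (Sx : S x = x') (Sx' : S x' = x) (Sg : S g = g') (Sg' : S g' = g)
  (Sy : S y = anti_y g' y) (Su : forall z, S (u z) = V z).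

Lemma hom_zp (C : ualgType k) (f : A -> C) (s s' : uring A) z : alg_hom f ->
  f (zp s s' z) = zp (f s : uring C) (f s') z.
Proof. by move=> hf; case: z => n; apply: homX. Qed.

Let D1 : Delta (1 : uring A) = t 1 1. Proof. by rewrite t1; case: hD. Qed.
Let DM (a b : uring A) : Delta (a * b) = (Delta a : uring E) * Delta b.
Proof. by case: hD => _ _; apply. Qed.
Let e1 : eps (1 : uring A) = 1. Proof. by case: he. Qed.
Let eM (a b : uring A) : eps (a * b) = eps a * eps b.
Proof. by case: he => _ _; apply. Qed.
Let S1 : S (1 : uring A) = 1 :> uring A. Proof. by case: hS. Qed.
Let SM (a b : uring A) : S (a * b) = (S b : uring A) * S a.
Proof. by case: hS => _ _; apply. Qed.

Lemma Delta_T a b : Delta (T a b) = t (T a b) (T a b).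
Proof.
by rewrite (gmonE x x' g g') DM !(hom_zp _ _ _ hD) Dx Dx' Dg Dg' !(t_zp t1 tM) tM.
Qed.

Lemma eps_T a b : eps (T a b) = 1.
Proof.
have eX (s : uring A) n : eps s = 1 -> eps (s ^+ n) = 1.
  by move=> s1; elim: n => // n IH; rewrite exprS eM IH s1 mulr1.
have ez (s s' : uring A) z : eps s = 1 -> eps s' = 1 -> eps (zp s s' z) = 1.
  by case: z => n *; apply: eX.
by rewrite (gmonE x x' g g') eM !ez // mulr1.
Qed.

Lemma S_T a b : S (T a b) = T (- a) (- b).
Proof.
rewrite (gmonE x x' g g') SM.
have Sz (s s' : uring A) z : S (zp s s' z) = zp (S s : uring A) (S s') z.
  by rewrite (hom_zp _ _ _ hS) uop_zp.
rewrite !Sz Sx Sx' Sg Sg' (zp_opp _ (Lxx' L) (Lx'x L)) (zp_opp _ (Lgg' L) (Lg'g L)).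
by rewrite (zp_comm L) -(gmonE x x' g g').
Qed.

(* [G1] and [G2] stand for the two sides of coassociativity, seen as linear
   maps on the tensor square; [r] and [l] are their partial evaluations, and
   [t3] the triple pure tensors. *)
Section Coassociativity.
Variables (C : lmodType k) (G1 G2 : E -> C) (r l : A -> E -> C)
  (t3 : uring A -> uring A -> uring A -> C).
Hypotheses (lG1 : linear G1) (lG2 : linear G2).
Hypotheses (lr : forall a, linear (r a)) (ll : forall a, linear (l a)).
Hypotheses (G1E : forall a b, G1 (t a b) = r b (Delta a))
  (G2E : forall a b, G2 (t a b) = l a (Delta b)).
Hypotheses (rE : forall a b c, r c (t a b) = t3 a b c)
  (lE : forall a b c, l a (t b c) = t3 a b c).

Lemma coassoc_gen c : is_gen c -> G1 (Delta c) = G2 (Delta c).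
Proof.
have glike a : Delta a = t a a -> G1 (Delta a) = G2 (Delta a).
  by move=> Da; rewrite Da G1E G2E Da rE lE.
case=> [||||| i]; try exact: glike.
  rewrite Dy (linD lG1) (linD lG2) !G1E !G2E Dy Dg D1 !(linD (lr _)) !(linD (ll _)).
  by rewrite !rE !lE addrA.
rewrite Du /cop_u (lin_sum lG1) (lin_sum lG2).
transitivity (\sum_(j < m) \sum_(l < m)
    (xp (2 * (j%:Z * (i - j%:Z))) * xp (2 * (l%:Z * (j%:Z - l%:Z)))) *:
      t3 (u l%:Z) (H l%:Z * u (j%:Z - l%:Z)) (H j%:Z * u (i - j%:Z))).
  apply: eq_bigr => j _.
  rewrite /cop_u_term (linZ lG1) G1E Du /cop_u (lin_sum (lr _)) scaler_sumr.
  by apply: eq_bigr => a _; rewrite /cop_u_term (linZ (lr _)) rE scalerA.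
rewrite (coassoc_sum m0 xi_prim L); apply: eq_bigr => j _.
rewrite /cop_u_term (linZ lG2) G2E DM Delta_T Du /cop_u mulr_sumr (lin_sum
  (ll _)) scaler_sumr.
by apply: eq_bigr => a _; rewrite /cop_u_term uscaleAr tM (linZ (ll _)) lE scalerA.
Qed.
End Coassociativity.

Lemma counitl_gen (f : E -> A) : linear f -> (forall a b, f (t a b) = eps a *: b) ->
  forall c, is_gen c -> f (Delta c) = c.
Proof.
move=> lf fE c; have glike a : Delta a = t a a -> eps a = 1 -> f (Delta a) = a.
  by move=> -> ea; rewrite fE ea scale1r.
case=> [||||| i]; try exact: glike.
  by rewrite Dy (linD lf) !fE ey e1 scale0r scale1r add0r.
rewrite Du /cop_u (lin_sum lf) (bigD1 (Ordinal m0)) //= big1 => [|j j0].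
  rewrite /cop_u_term (linZ lf) fE eu dvdz0 scale1r addr0 subr0 /hpow.
  have -> : H 0 = 1 by rewrite mul0r oppr0 (gmon0 x x' g g').
  by rewrite mul1r mul0r mulr0 xp0 scale1r.
rewrite /cop_u_term (linZ lf) fE eu -resm_eq0 resm_small //.
by move: j0; rewrite -val_eqE /= => /negPf->; rewrite scale0r scaler0.
Qed.

Lemma counitr_gen (f : E -> A) : linear f -> (forall a b, f (t a b) = eps b *: a) ->
  forall c, is_gen c -> f (Delta c) = c.
Proof.
move=> lf fE c; have glike a : Delta a = t a a -> eps a = 1 -> f (Delta a) = a.
  by move=> -> ea; rewrite fE ea scale1r.
case=> [||||| i]; try exact: glike.
  by rewrite Dy (linD lf) !fE ey eg scale0r scale1r addr0.
rewrite Du /cop_u (lin_sum lf) (bigD1 (ordz m0 i)) //= big1 => [|j ji].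
  have [q qE] := resmE m0 i.
  rewrite /cop_u_term (linZ lf) fE eM eps_T eu mul1r (per_resm m0 (Lum L)) addr0.
  have -> : i - (resm m i)%:Z = m%:Z * - q by rewrite qE; ring.
  rewrite dvdz_mulr // scale1r (_ : xp _ = 1) ?scale1r //.
  apply/eqP; rewrite (xp_eq1 xi_prim) dvdz_mul2l //.
  by rewrite mulrCA dvdz_mulr.
rewrite /cop_u_term (linZ lf) fE eM eps_T eu mul1r.
case: (boolP (_ %| _)%Z) => [|_]; last by rewrite scale0r scaler0.
case/dvdzP=> q ijE; case/eqP: ji; apply: val_inj => /=.
have -> : i = j%:Z + m%:Z * q by rewrite mulrC -ijE; ring.
by rewrite resmD resm_small.
Qed.

Lemma antipodel_gen (f : E -> A) : linear f ->
  (forall a b, f (t a b) = (S a : uring A) * b) ->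
  forall c, is_gen c -> f (Delta c) = eps c *: (1 : uring A).
Proof.
move=> lf fE c; case=> [||||| i].
- by rewrite Dx fE Sx (Lx'x L) ex scale1r.
- by rewrite Dx' fE Sx' (Lxx' L) ex' scale1r.
- by rewrite Dg fE Sg (Lg'g L) eg scale1r.
- by rewrite Dg' fE Sg' (Lgg' L) eg' scale1r.
- rewrite Dy (linD lf) !fE Sy S1 ey scale0r /anti_y mulNr -mulrA (Lg'g L) mulr1 mul1r.
  exact: addNr.
rewrite Du /cop_u (lin_sum lf).
transitivity ((m%:Z %| i)%Z%:R : uring A); last first.
  by rewrite eu; case: (_ %| _)%Z; rewrite ?scale1r ?scale0r.
rewrite -(antipodel_sum m0 xi_prim parity L mR); apply: eq_bigr => j _.
by rewrite /cop_u_term (linZ lf) fE Su.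
Qed.

Lemma antipoder_gen (f : E -> A) : linear f ->
  (forall a b, f (t a b) = a * (S b : uring A)) ->
  forall c, is_gen c -> f (Delta c) = eps c *: (1 : uring A).
Proof.
move=> lf fE c; case=> [||||| i].
- by rewrite Dx fE Sx (Lxx' L) ex scale1r.
- by rewrite Dx' fE Sx' (Lx'x L) ex' scale1r.
- by rewrite Dg fE Sg (Lgg' L) eg scale1r.
- by rewrite Dg' fE Sg' (Lg'g L) eg' scale1r.
- rewrite Dy (linD lf) !fE Sy Sg ey scale0r /anti_y mul1r.
  exact: addrN.
rewrite Du /cop_u (lin_sum lf).
transitivity ((m%:Z %| i)%Z%:R : uring A); last first.
  by rewrite eu; case: (_ %| _)%Z; rewrite ?scale1r ?scale0r.
rewrite -(antipoder_sum m0 xi_prim parity L mR); apply: eq_bigr => j _.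
by rewrite /cop_u_term (linZ lf) fE SM Su S_T opprK.
Qed.
End Hopf.

(** * From the generators to the whole algebra *)

Section CoassocMaps.
Variables (k : comNzRingType) (A : ualgType k) (Delta : A -> tens A A).
Hypothesis hD : alg_hom Delta.
Let lD : linear Delta := hom_lin hD.
Let idl : linear (id : A -> A). Proof. by []. Qed.

Definition coassocl (t : tens A A) : tens A (tens A A) := tens_assoc (tens_map Delta id t).
Definition coassocr (t : tens A A) : tens A (tens A A) := tens_map id Delta t.

Lemma alg_hom_coassocl : alg_hom coassocl.
Proof.
exact: (alg_hom_comp (alg_hom_tens_assoc A A A) (alg_hom_tens_map hD (alg_hom_id A))).
Qed.
Lemma alg_hom_coassocr : alg_hom coassocr.
Proof. exact: (alg_hom_tens_map (alg_hom_id A) hD). Qed.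
Lemma coassocl_lin : linear coassocl.
Proof. exact: (linear_comp (@tens_assoc_lin _ A A A) (tens_map_lin lD idl)). Qed.
Lemma coassocr_lin : linear coassocr.
Proof. exact: (tens_map_lin idl lD). Qed.
Lemma coassoclE (a b : A) : coassocl (pure a b) = assoc_at b (Delta a).
Proof. by rewrite /coassocl (tens_mapE a b lD idl) tens_assoc_pure. Qed.
Lemma coassocrE (a b : A) : coassocr (pure a b) = pure a (Delta b).
Proof. exact: (tens_mapE a b idl lD). Qed.
End CoassocMaps.

(* The abstract pairing of the previous part is now the tensor square of [A],
   and [gen_ind] says that [A] is generated by the given elements. *)
Section HopfTens.
Variables (k : fieldType) (m d : nat) (xi : k).
Hypotheses (m0 : (0 < m)%N) (xi_prim : (2 * m).-primitive_root xi).
Hypothesis parity : ~~ odd ((1 + m) * d).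
Hypothesis mR : m%:R != 0 :> k.

Variables (A : ualgType k) (x x' g g' y : uring A) (u : int -> uring A).
Hypothesis L : Dlaws m d xi x x' g g' y u.
Local Notation is_gen := (is_gen x x' g g' y u).
Hypothesis gen_ind : forall P : A -> Prop, submodule P -> P aone ->
  (forall c a : A, is_gen c -> P a -> P (c ** a)) -> forall a, P a.
Local Notation t := (@upure k A A).

Variables (Delta : A -> tens A A) (eps : A -> k) (S : A -> A).
Hypotheses (hD : alg_hom Delta) (he : alg_hom (eps : A -> k^o))
  (hS : alg_hom (S : A -> uop A)).
Hypotheses (Dx : Delta x = t x x) (Dx' : Delta x' = t x' x')
  (Dg : Delta g = t g g) (Dg' : Delta g' = t g' g')
  (Dy : Delta y = t y g + t 1 y) (Du : forall z, Delta
    (u z) = cop_u m d xi x x' g g' u t z).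
Hypotheses (ex : eps x = 1) (ex' : eps x' = 1) (eg : eps g = 1) (eg' : eps g' = 1)
  (ey : eps y = 0) (eu : forall z, eps (u z) = (m%:Z %| z)%Z%:R).
Hypotheses (Sx : S x = x') (Sx' : S x' = x) (Sg : S g = g') (Sg' : S g' = g)
  (Sy : S y = anti_y g' y) (Su : forall z, S (u z) = anti_u m d xi x x' g g' u z).

(** Algebra maps agreeing on generators agree; coassociativity and the counit
    axioms are of this form. *)
Lemma eq_hom_gen (C : ualgType k) (f h : A -> C) : alg_hom f -> alg_hom h ->
  (forall c : A, is_gen c -> f c = h c) -> forall a, f a = h a.
Proof.
move=> [lf f1 fM] [lh h1 hM] fh; apply: gen_ind.
- exact: linear_eq_submodule.
- by rewrite f1 h1.
by move=> c a gc fha; rewrite fM hM (fh _ gc) fha.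
Qed.

Let t1 : t 1 1 = 1 := upure1 A A.
Let tM : forall a b a' b', t a b * t a' b' = t (a * a') (b * b').
Proof. by move=> *; apply: upureM. Qed.

Lemma coassoc a : coassocl Delta (Delta a) = coassocr Delta (Delta a).
Proof.
have h1 := alg_hom_coassocl hD; have h2 := alg_hom_coassocr hD.
refine (eq_hom_gen (alg_hom_comp h1 hD) (alg_hom_comp h2 hD) _ a) => c gc.
exact: (@coassoc_gen k m d xi m0 xi_prim A x x' g g' y u L _ t t1 tM Delta hD
  Dx Dx' Dg Dg' Dy Du _ _ _ (fun c t => assoc_at c t) (fun a t => pure a t)
  (fun a b c => pure a (pure b c)) (coassocl_lin hD) (coassocr_lin hD)
  (@assoc_at_lin _ A A A) (pure_bilinear A (tens A A)).2 (coassoclE hD) (coassocrE hD)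
  (fun a b c => assoc_atE c a b) (fun a b c => erefl) c gc).
Qed.

Lemma counitl_id a : tens_lift (fun a b : A => eps a *: b) (Delta a) = a.
Proof.
have hC := alg_hom_counitl he.
refine (eq_hom_gen (alg_hom_comp hC hD) (alg_hom_id A) _ a) => c gc.
exact: (counitl_gen m0 he Dx Dx' Dg Dg' Dy Du ex ex' eg eg' ey eu (hom_lin hC)
  (fun a b => tens_liftE a b (counitl_bil he)) gc).
Qed.

Lemma counitr_id a : tens_lift (fun a b : A => eps b *: a) (Delta a) = a.
Proof.
have hC := alg_hom_counitr he.
refine (eq_hom_gen (alg_hom_comp hC hD) (alg_hom_id A) _ a) => c gc.
exact: (counitr_gen m0 xi_prim L he Dx Dx' Dg Dg' Dy Du ex ex' eg eg' ey eu (hom_lin hC)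
  (fun a b => tens_liftE a b (counitr_bil he)) gc).
Qed.

Lemma antipodel_all a : antil_at Delta eps S a.
Proof.
move: a; apply: gen_ind.
- exact: antil_submodule.
- exact: antil1.
move=> c a gc; apply: (antilM hD he hS).
exact: (antipodel_gen m0 xi_prim parity mR L hS Dx Dx' Dg Dg' Dy Du ex ex' eg eg' ey eu
  Sx Sx' Sg Sg' Sy Su (tens_lift_linear (antil_bil hS))
  (fun a b => tens_liftE a b (antil_bil hS)) gc).
Qed.

Lemma antipoder_all a : antir_at Delta eps S a.
Proof.
move: a; apply: gen_ind.
- exact: antir_submodule.
- exact: antir1.
move=> c a gc; apply: (antirM hD he hS).
exact: (antipoder_gen m0 xi_prim parity mR L hS Dx Dx' Dg Dg' Dy Du ex ex' eg eg' ey eu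
  Sx Sx' Sg Sg' Sy Su (tens_lift_linear (antir_bil hS))
  (fun a b => tens_liftE a b (antir_bil hS)) gc).
Qed.

(** Multiplicativity comes with the three maps; the remaining axioms have been
    propagated from the generators. *)
Theorem hopf_of_generators : is_hopf_algebra Delta eps S.
Proof.
have [lD D1 DM] := hD; have [le e1 eM] := he; have [lS S1 SM] := hS.
split=> //.
- exact: coassoc.
- exact: counitl_id.
- exact: counitr_id.
- exact: antipodel_all.
- exact: antipoder_all.
Qed.
End HopfTens.

(** * The Hopf algebra D(m, d, xi) *)

Section CoproductPure.
Variables (k : fieldType) (m d : nat) (xi : k) (A : ualgType k).
Variables (x x' g g' y : uring A) (u : int -> uring A).

Lemma cop_y_pure : cop_y g y (@upure k A A) = pure (y : A) (g : A) + pure (aone : A)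
  (y : A).
Proof. by []. Qed.

Lemma cop_u_pure z : cop_u m d xi x x' g g' u (@upure k A A) z =
  \sum_(j < m) (xi ^+ 2) ^ (j%:Z * (z - j%:Z)) *:
    pure (u j%:Z : A) (zp x x' (- (j * d)%N%:Z) * g ^+ j * u (z - j%:Z) : A).
Proof.
apply: eq_bigr => j _; rewrite /cop_u_term /hpow gmonE; apply: eq_scale => //.
by apply/esym/(xpZ xi 2).
Qed.
End CoproductPure.

(** The passage from [h^(-i-1)] to a nonnegative power of [g] multiplies by
    [x^(-md)]; with [2 f = (m - 1) d] the exponent [(i + 1) d - f - m d] is
    [i d - 3 f]. *)
Lemma anti_u_explicit (k : fieldType) (m d : nat) (xi : k) (A : ualgType k)
    (x x' g g' y : uring A) (u : int -> uring A) (i : nat) :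
  (0 < m)%N -> (2 * m).-primitive_root xi -> ~~ odd ((1 + m) * d) ->
  Dlaws m d xi x x' g g' y u -> (i < m)%N ->
  anti_u m d xi x x' g g' u i%:Z =
  ((-1) ^+ i * xi ^- i * (xi ^+ 2) ^- (i * (i + 1))./2) *:
    (zp x x' ((i * d)%N%:Z - 3 * ((m - 1) * d)./2%:Z) * g ^+ (m - i - 1) * u i%:Z).
Proof.
move=> m0 xi_prim parity L im; rewrite /anti_u; apply: eq_scale.
  rewrite (sgn_xp m0 xi_prim) !(xiX xi) xpX !xpV half2 -!(xpD m0 xi_prim).
  by congr xp; rewrite /anti_exp; ring.
rewrite -[g ^+ _]/(zp g g' (m - i - 1)%N%:Z) -gmonE; congr (_ * _).
have -> : (m - i - 1)%N%:Z = - i%:Z - 1 + m%:Z * 1 by lia.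
rewrite (gmon_period L); congr (gmon _ _ _ _ _ _).
have := double_f m0 parity; rewrite !PoszM; move: (_./2) => f fE.
transitivity (i%:Z * d%:Z + d%:Z - f%:Z + ((m%:Z - 1) * d%:Z - f%:Z * 2)).
  by rewrite fE; ring.
by ring.
Qed.

Section Final.
Variables (k : fieldType) (m d : nat) (xi : k).
Hypotheses (m0 : (0 < m)%N) (xi_prim : (2 * m).-primitive_root xi).
Hypothesis parity : ~~ odd ((1 + m) * d).
Hypothesis mR : m%:R != 0 :> k.

Local Notation D := (algD m d xi).

Definition gen (i : D_gen m) : uring D := presented_proj (D_rel d xi) (free_gen k i).
Definition ugen (z : int) : uring D := gen (Gu (ordz m0 z)).

Lemma ugen_period z : ugen (z + m%:Z) = ugen z.
Proof. by congr (gen (Gu _)); apply: val_inj => /=; rewrite resmDm. Qed.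
Lemma ugen_ord (i : 'I_m) : gen (Gu i) = ugen i%:Z.
Proof. by congr (gen (Gu _)); apply: val_inj => /=; rewrite resm_small. Qed.

Lemma DprojE a : Dproj d xi a = feval gen a.
Proof. by rewrite feval_proj. Qed.

Lemma algD_laws : Dlaws m d xi (gen Gx) (gen Gxinv) (gen Gg) (gen Gginv) (gen Gy) ugen.
Proof.
apply: (rel_laws m0 xi_prim ugen_period ugen_ord) => l r lr.
rewrite !feval_proj; apply: qproj_eq.
by rewrite -[l - r]mul1r -[1 * _]mulr1; apply: IdealGen.
Qed.

Section Univ.
Variables (B : ualgType k) (bx bx' bg bg' by_ : uring B) (bu : int -> uring B).
Hypothesis L : Dlaws m d xi bx bx' bg bg' by_ bu.

Definition gen_map (i : D_gen m) : uring B :=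
  match i with
  | Gx => bx | Gxinv => bx' | Gg => bg | Gginv => bg' | Gy => by_ | Gu j => bu j%:Z
  end.

(** Universal property of D(m, d, xi) in terms of the integer-indexed
    relations. *)
Lemma algD_rec : exists2 h : D -> B, alg_hom h &
  [/\ h (gen Gx) = bx, h (gen Gxinv) = bx', h (gen Gg) = bg, h (gen Gginv) = bg' &
      h (gen Gy) = by_ /\ forall z, h (ugen z) = bu z].
Proof.
have H := laws_rel (f := gen_map) m0 xi_prim (Lum L) (fun i => erefl) L.
have [h hh hE] := presented_rec H; exists h => //.
have hg i : h (gen i) = gen_map i by rewrite hE feval_gen.
by split; rewrite ?hg //; split=> // z; rewrite hg /= (per_resm m0 (Lum L)).
Qed.
End Univ.

Local Notation is_gen := (is_gen (gen Gx) (gen Gxinv) (gen Gg) (gen Gginv) (gen Gy) ugen).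

Lemma algD_ind (P : D -> Prop) : submodule P -> P aone ->
  (forall c a : D, is_gen c -> P a -> P (c ** a)) -> forall a, P a.
Proof.
move=> sP P1 PM; apply: presented_proj_gen_ind => // i a Pa; apply: PM => //.
case: i => [||||| j]; [exact: Genx|exact: Genx'|exact: Geng|exact: Geng'|exact: Geny|].
rewrite -[presented_proj _ _]/(gen (Gu j)) ugen_ord; exact: Genu.
Qed.

Lemma DprojXGU z n (i : 'I_m) : Dproj d xi (fxz k m z * fg k m ^+ n * fu k i) =
  zp (gen Gx) (gen Gxinv) z * gen Gg ^+ n * ugen i%:Z.
Proof.
rewrite DprojE; apply: evM; last exact: (feval_fu ugen_ord).
by apply: evM; [exact: feval_fxz | apply: evX; exact: feval_fg].
Qed.

Lemma ugen_sub (i j : 'I_m) : ugen (ord_sub i j)%:Z = ugen (i%:Z - j%:Z).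
Proof.
rewrite /= -(per_resm m0 ugen_period (i%:Z - j%:Z)); congr (ugen _%:Z).
have jm := ltn_ord j.
rewrite -[RHS](resmDm m) (_ : i%:Z - j%:Z + m%:Z = (i + (m - j))%N%:Z); last by lia.
by rewrite /resm modz_nat.
Qed.

Lemma Dproj_x : Dproj d xi (fx k m) = gen Gx. Proof. by []. Qed.
Lemma Dproj_g : Dproj d xi (fg k m) = gen Gg. Proof. by []. Qed.
Lemma Dproj_y : Dproj d xi (fy k m) = gen Gy. Proof. by []. Qed.
Lemma Dproj_xinv : Dproj d xi (fxinv k m) = gen Gxinv. Proof. by []. Qed.
Lemma Dproj_ginv : Dproj d xi (fginv k m) = gen Gginv. Proof. by []. Qed.
Lemma Dproj_ugen (i : 'I_m) : Dproj d xi (fu k i) = ugen i%:Z.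
Proof. by rewrite -ugen_ord. Qed.

Lemma upure_gens (a b : D) : upure (a : uring D) (b : uring D) = pure a b :> tens D D.
Proof. by []. Qed.

Lemma cop_y_gens : (cop_y (gen Gg) (gen Gy) (@upure k D D) : tens D D) =
  pure (Dproj d xi (fy k m)) (Dproj d xi (fg k m)) +
  pure (Dproj d xi 1) (Dproj d xi (fy k m)) :> tens D D.
Proof. exact: cop_y_pure. Qed.

Lemma cop_u_gens (i : 'I_m) :
  (cop_u m d xi (gen Gx) (gen Gxinv) (gen Gg) (gen Gginv) ugen
    (@upure k D D) i%:Z : tens D D) =
  \sum_(j < m) (xi ^+ 2) ^ (j%:Z * (i%:Z - j%:Z)) *:
    pure (Dproj d xi (fu k j))
      (Dproj d xi (fxz k m (- (j * d)%N%:Z) * fg k m ^+ j * fu k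
        (ord_sub i j))) :> tens D D.
Proof.
under eq_bigr => j _ do rewrite DprojXGU Dproj_ugen ugen_sub.
exact: cop_u_pure.
Qed.

Lemma anti_u_gens (i : 'I_m) :
  (anti_u m d xi (gen Gx) (gen Gxinv) (gen Gg) (gen Gginv) ugen i%:Z : D) =
  ((-1) ^+ i * xi ^- i * (xi ^+ 2) ^- (i * (i + 1))./2) *:
          Dproj d xi (fxz k m ((i * d)%N%:Z - 3 * ((m - 1) * d)./2%:Z)
                 * fg k m ^+ (m - i - 1) * fu k i) :> D.
Proof.
by rewrite (anti_u_explicit m0 xi_prim parity algD_laws (ltn_ord i)) DprojXGU.
Qed.

Theorem algD_hopf :
  exists (Delta : D -> tens D D) (eps : D -> k) (S : D -> D),
    [/\ D_coproduct_gens Delta, D_counit_gens eps,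
        D_antipode_gens S, anti_homomorphism S &
        is_hopf_algebra Delta eps S].
Proof.
have L := algD_laws.
have tb : Defs.bilinear (@upure k D D) := pure_bilinear D D.
have tM : forall a b a' b', upure a b * upure a' b' = upure (a * a') (b * b') :> uring
  (tens D D).
  by move=> *; apply: upureM.
have LD := coproduct_laws m0 xi_prim L tb (upure1 D D) tM mR.
have Le := counit_laws d m0 xi_prim mR (k^o : ualgType k).
have LS := antipode_laws m0 xi_prim parity L.
have [Delta hD [Dx Dx' Dg Dg' [Dy Du]]] := algD_rec LD.
have [eps he [ex ex' eg eg' [ey eu]]] := algD_rec Le.
have [S hS [Sx Sx' Sg Sg' [Sy Su]]] := algD_rec LS.
have eu' z : eps (ugen z) = (m%:Z %| z)%Z%:R.
  by rewrite eu /delta; case: (_ %| _)%Z.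
exists Delta, eps, S; split.
- split=> [||| i].
  + exact: etrans Dx (upure_gens _ _).
  + exact: etrans Dg (upure_gens _ _).
  + exact: etrans Dy cop_y_gens.
  + exact: etrans (congr1 Delta (Dproj_ugen i)) (etrans (Du i%:Z) (cop_u_gens i)).
- split=> [||| i].
  + by rewrite Dproj_x ex.
  + by rewrite Dproj_g eg.
  + by rewrite Dproj_y ey.
  by rewrite Dproj_ugen eu' -resm_eq0 resm_small.
- split=> [||| i].
  + by rewrite Dproj_x Sx Dproj_xinv.
  + by rewrite Dproj_g Sg Dproj_ginv.
  + rewrite Dproj_y [LHS]Sy /anti_y DprojE -!scaleN1r; apply/esym/evZ/evM;
    first exact: feval_fy.
    exact: feval_fginv.
  + by rewrite Dproj_ugen Su anti_u_gens.
- by case: hS => lS S1 SM; split.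
exact: (hopf_of_generators m0 xi_prim parity mR L algD_ind hD he hS
  Dx Dx' Dg Dg' Dy Du ex ex' eg eg' ey eu' Sx Sx' Sg Sg' Sy Su).
Qed.
End Final.

Theorem proposition4p2 (k : closedFieldType) (m d : nat) (xi : k) :
  [pchar k] =i pred0 ->
  (0 < m)%N -> (0 < d)%N -> ~~ odd ((1 + m) * d) ->
  (2 * m).-primitive_root xi ->
  exists (Delta : algD m d xi -> tens (algD m d xi) (algD m d xi))
         (eps : algD m d xi -> k) (S : algD m d xi -> algD m d xi),
    [/\ D_coproduct_gens Delta, D_counit_gens eps,
        D_antipode_gens S, anti_homomorphism S &
        is_hopf_algebra Delta eps S].
Proof.
move=> char0 m0 _ parity xi_prim; apply: algD_hopf => //.
by move/pcharf0P: char0 => ->; rewrite -lt0n.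
Qed.
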